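(* Let $n\ge 2$, $f\in D_{L^1}'(\mathbb{R}^n)$ and $\psi\in\mathcal{S}_1(\mathbb{R})$. Then the distributional directional Stockwell transform $DS_\psi f\in\mathcal{S}'(\mathbb{Y}^{n+1})$ (defined by duality) is given by the pointwise-defined function $DS_\psi f(\mathbf{u},b,a)=\langle f(\mathbf{x}),\overline{\psi_{\mathbf{u},b,a}(\mathbf{x})}\rangle_{\mathbf{x}}$, i.e. for every $\Phi\in\mathcal{S}(\mathbb{Y}^{n+1})$, $$\langle DS_\psi f,\Phi\rangle=\int_{\mathbb{S}^{n-1}}\int_{\mathbb{R}^{\times}}\int_{\mathbb{R}}DS_\psi f(\mathbf{u},b,a)\,\Phi(\mathbf{u},b,a)\,|a|^{n-2}\,db\,da\,d\mathbf{u}.$$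
   Context: $\mathcal{S}(\mathbb{R}^d)$ is the Schwartz space of complex-valued functions with its usual topology. The Lizorkin space $\mathcal{S}_0(\mathbb{R}^d)$ consists of all $\varphi\in\mathcal{S}(\mathbb{R}^d)$ with $\int_{\mathbb{R}^d}\mathbf{x}^m\varphi(\mathbf{x})\,d\mathbf{x}=0$ for all multi-indices $m\in\mathbb{N}_0^d$, with the topology inherited from $\mathcal{S}(\mathbb{R}^d)$. $\mathcal{S}_1(\mathbb{R})=\{\varphi\in\mathcal{S}(\mathbb{R}):\ e^{ix}\varphi(x)\in\mathcal{S}_0(\mathbb{R})\}$. $\mathbb{R}^\times=\mathbb{R}\setminus\{0\}$ and $\mathbb{Y}^{n+1}=\mathbb{S}^{n-1}\times\mathbb{R}\times\mathbb{R}^\times$, where $\mathbb{S}^{n-1}$ is the unit sphere of $\mathbb{R}^n$ with surface measure $d\mathbf{u}$. $\mathcal{S}(\mathbb{Y}^{n+1})$ is the space of all $\Phi\in C^\infty(\mathbb{Y}^{n+1})$ such that $$\rho_{s,r}^{l,m,k}(\Phi)=\sup_{(\mathbf{u},b,a)\in\mathbb{Y}^{n+1}}(1+|b|^2)^{r/2}(|a|^s+|a|^{-s})\,|\partial_a^l\partial_b^m\Delta_{\mathbf{u}}^k\Phi(\mathbf{u},b,a)|<\infty$$ for all $s,r,l,m,k\in\mathbb{N}_0$, where $\Delta_{\mathbf{u}}$ is the Laplace–Beltrami operator on $\mathbb{S}^{n-1}$, with the topology given by these seminorms. $\mathcal{S}_0'(\mathbb{R}^n)$ and $\mathcal{S}'(\mathbb{Y}^{n+1})$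 are the topological duals of $\mathcal{S}_0(\mathbb{R}^n)$ and $\mathcal{S}(\mathbb{Y}^{n+1})$; $\langle\cdot,\cdot\rangle$ is the (bilinear) dual pairing. Put $\psi_{\mathbf{u},b,a}(\mathbf{x})=\frac{|a|}{(2\pi)^{n/2}}\psi\big(a(\mathbf{x}\cdot\mathbf{u}-b)\big)e^{ia(\mathbf{x}\cdot\mathbf{u})}$. The synthesis operator on $\Phi\in\mathcal{S}(\mathbb{Y}^{n+1})$ is $$DS_\psi^{*}\Phi(\mathbf{x})=\int_{\mathbb{S}^{n-1}}\int_{\mathbb{R}^\times}\int_{\mathbb{R}}\Phi(\mathbf{u},b,a)\psi_{\mathbf{u},b,a}(\mathbf{x})|a|^{n-2}\,db\,da\,d\mathbf{u},$$ which maps $\mathcal{S}(\mathbb{Y}^{n+1})$ continuously into $\mathcal{S}_0(\mathbb{R}^n)$ when $\psi\in\mathcal{S}_1(\mathbb{R})$. For $f\in\mathcal{S}_0'(\mathbb{R}^n)$ and $\psi\in\mathcal{S}_1(\mathbb{R})$, the distributional directional Stockwell transform $DS_\psi f\in\mathcal{S}'(\mathbb{Y}^{n+1})$ is defined by $\langle DS_\psi f,\Phi\rangle=\big\langle f,\overline{DS_\psi^{*}\overline{\Phi}}\big\rangle$ for $\Phi\in\mathcal{S}(\mathbb{Y}^{n+1})$. $D_{L^1}'(\mathbb{R}^n)$ is the space of distributions $f$ that can be written as $f=\sum_{j=1}^N\partial^{\alpha_j}f_j$ with $N\in\mathbb{N}$, $\alpha_j\in\mathbb{N}_0^n$, $f_j\in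 L^1(\mathbb{R}^n)$ (distributional derivatives); such $f$ is a tempered distribution and is regarded as an element of $\mathcal{S}_0'(\mathbb{R}^n)$ by restriction to $\mathcal{S}_0(\mathbb{R}^n)$. For such $f$, the pointwise-defined function is $$DS_\psi f(\mathbf{u},b,a)=\langle f(\mathbf{x}),\overline{\psi_{\mathbf{u},b,a}(\mathbf{x})}\rangle_{\mathbf{x}}=\sum_{j=1}^N(-1)^{|\alpha_j|}\int_{\mathbb{R}^n}f_j(\mathbf{x})\,\overline{\partial_{\mathbf{x}}^{\alpha_j}\psi_{\mathbf{u},b,a}(\mathbf{x})}\,d\mathbf{x},\qquad(\mathbf{u},b,a)\in\mathbb{Y}^{n+1}.$$ *)

(* Defs.v *)
From HB Require Import structures.
From mathcomp Require Import all_boot all_order all_algebra.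
From mathcomp Require Import all_classical all_reals all_analysis.
From mathcomp Require Import measurable_realfun measurable_fun_approximation.
From mathcomp.real_closed Require Import complex.

Set Implicit Arguments.
Unset Strict Implicit.
Unset Printing Implicit Defensive.
Import Order.TTheory GRing.Theory Num.Theory.
Import numFieldNormedType.Exports.

Local Open Scope classical_set_scope.
Local Open Scope ring_scope.
Local Open Scope complex_scope.

Local Notation normc := ComplexField.Normc.normc.

(* The Borel sigma-algebra of R^n, generated by the coordinate maps. *)

Definition rV_display : measure_display.
Proof. by constructor. Qed.

Section measurable_rV.
Variables (R : realType) (n : nat).

Definition rV_coord (i : 'I_n) (x : 'rV[R]_n) : measurableTypeR R := x ord0 i.

Let rV_set0 : g_sigma_preimage rV_coord set0.
Proof. exact: sigma_algebra0. Qed.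

Let rV_setC A : g_sigma_preimage rV_coord A -> g_sigma_preimage rV_coord (~` A).
Proof. exact: sigma_algebraC. Qed.

Let rV_bigcup (F : _^nat) : (forall i, g_sigma_preimage rV_coord (F i)) ->
  g_sigma_preimage rV_coord (\bigcup_i (F i)).
Proof. exact: sigma_algebra_bigcup. Qed.

HB.instance Definition _ := @isMeasurable.Build rV_display
  'rV[R]_n (g_sigma_preimage rV_coord) rV_set0 rV_setC rV_bigcup.

Lemma measurable_rV_coord (i : 'I_n) : measurable_fun setT (rV_coord i).
Proof.
move=> _ Y mY; rewrite setTI; apply: sub_sigma_algebra => /=.
rewrite -bigcup_seq/=; exists i => /=; first by rewrite mem_index_enum.
by exists Y => //; rewrite setTI.
Qed.

Lemma measurable_fun_rV d (T : measurableType d) (f : T -> 'rV[R]_n) :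
  (forall i, measurable_fun setT (rV_coord i \o f)) -> measurable_fun setT f.
Proof.
move=> mf; apply: (@measurability _ _ _ _ setT f
  (\big[setU/set0]_(i < n) preimage_set_system setT (rV_coord i) measurable)).
  by [].
move=> _ [B mB <-]; move: mB; rewrite -bigcup_seq/= => -[i _ [C mC <-]].
by rewrite !setTI; have := mf i measurableT C mC; rewrite setTI.
Qed.

End measurable_rV.

(* Lebesgue measure on R^n as the n-fold product of that of R. *)

Section lebesgue_measure_rV.
Variable R : realType.

Definition rV_cons n (p : 'rV[R]_n * measurableTypeR R) : 'rV[R]_n.+1 :=
  \row_i (if unlift ord0 i is Some j then p.1 ord0 j else p.2 : R).

Lemma measurable_rV_cons n : measurable_fun setT (@rV_cons n).
Proof.
apply: measurable_fun_rV => i.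
case: (unliftP ord0 i) => [j|] ->.
  rewrite (_ : _ \o _ = @rV_coord R n j \o fst); last first.
    by apply/funext => p; rewrite /rV_coord /rV_cons/= mxE liftK.
  apply: measurableT_comp; last exact: measurable_fst.
  exact: measurable_rV_coord.
rewrite (_ : _ \o _ = snd); first exact: measurable_snd.
by apply/funext => p; rewrite /rV_coord /rV_cons/= mxE unlift_none.
Qed.

Section succ.
Variables (n : nat) (m : {measure set 'rV[R]_n -> \bar R}).

Definition lebesgue_rV_succ : set 'rV[R]_n.+1 -> \bar R :=
  pushforward (m \x (@lebesgue_measure R))%E (@rV_cons n).

Let succ0 : lebesgue_rV_succ set0 = 0%E.
Proof. by rewrite /lebesgue_rV_succ /pushforward preimage_set0 measure0. Qed.

Let succ_ge0 A : (0 <= lebesgue_rV_succ A)%E.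
Proof. by rewrite /lebesgue_rV_succ /pushforward; exact: measure_ge0. Qed.

Let succ_sigma_additive : semi_sigma_additive lebesgue_rV_succ.
Proof.
have mc := @measurable_rV_cons n.
move=> F mF tF mUF; rewrite /lebesgue_rV_succ /pushforward preimage_bigcup.
apply: measure_semi_sigma_additive.
- by move=> k; rewrite -[X in measurable X]setTI; exact: mc.
- apply/trivIsetP => /= i j _ _ ij; rewrite -preimage_setI.
  by move/trivIsetP : tF => /(_ _ _ _ _ ij) ->//; rewrite preimage_set0.
- by rewrite -preimage_bigcup -[X in measurable X]setTI; exact: mc.
Qed.

HB.instance Definition _ := isMeasure.Build _ _ _ lebesgue_rV_succ
  succ0 succ_ge0 succ_sigma_additive.
End succ.

Fixpoint lebesgue_rV (n : nat) : {measure set 'rV[R]_n -> \bar R} :=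
  match n with
  | 0 => \d_ (0 : 'rV[R]_0)
  | k.+1 => lebesgue_rV_succ (lebesgue_rV k)
  end.

End lebesgue_measure_rV.

(* The norm that the library puts on 'rV_n is the sup norm, whence [enorm]. *)

Section euclidean.
Variables (R : realType) (n : nat).
Implicit Types x y : 'rV[R]_n.

Definition dotv x y : R := \sum_i x ord0 i * y ord0 i.
Definition enorm x : R := Num.sqrt (dotv x x).
Definition sphere : set 'rV[R]_n := [set u | enorm u = 1].
Definition direction x : 'rV[R]_n := (enorm x)^-1 *: x.
Definition punctured_ball : set 'rV[R]_n := [set x | 0 < enorm x <= 1].

Lemma measurable_enorm : measurable_fun setT enorm.
Proof.
apply: (@measurableT_comp _ _ _ _ _ _ (@Num.sqrt R)).
  by apply: continuous_measurable_fun; exact: sqrt_continuous.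
by apply: measurable_sum => i; apply: measurable_funM;
  exact: (@measurable_rV_coord R n i).
Qed.

Lemma measurable_direction : measurable_fun setT direction.
Proof.
apply: measurable_fun_rV => i.
rewrite (_ : _ \o _ = (fun x => enorm x `^ (- 1) * rV_coord i x)); last first.
  apply/funext => x; rewrite /rV_coord /direction/= mxE powR_inv1//.
  exact: sqrtr_ge0.
apply: measurable_funM; last exact: measurable_rV_coord.
by apply: (@measurableT_comp _ _ _ _ _ _ (@powR R ^~ (- 1)));
  [exact: measurable_powR|exact: measurable_enorm].
Qed.

Lemma measurable_punctured_ball : measurable punctured_ball.
Proof.
rewrite (_ : punctured_ball = enorm @^-1` `]0, 1]).
  by rewrite -[X in measurable X]setTI; exact: measurable_enorm.
by apply/funext => x; rewrite /punctured_ball/= in_itv.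
Qed.

(* The surface measure of the unit sphere is the cone measure
   A |-> n * Leb {x | 0 < |x| <= 1, x / |x| \in A}, carried by R^n. *)
Definition surface_measure (A : set 'rV[R]_n) : \bar R :=
  (n%:R%:E * lebesgue_rV R n (direction @^-1` A `&` punctured_ball))%E.

Let surface0 : surface_measure set0 = 0%E.
Proof. by rewrite /surface_measure preimage_set0 set0I measure0 mule0. Qed.

Let surface_ge0 A : (0 <= surface_measure A)%E.
Proof. by rewrite /surface_measure mule_ge0// lee_fin ler0n. Qed.

Let surface_sigma_additive : semi_sigma_additive surface_measure.
Proof.
move=> F mF tF mUF.
rewrite [X in X @ \oo --> _](_ : _ = (fun k => n%:R%:E * \sum_(0 <= i < k)
    lebesgue_rV R n (direction @^-1` F i `&` punctured_ball))%E); last first.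
  by apply/funext => k; rewrite ge0_sume_distrr.
rewrite /surface_measure; apply: cvgeZl => //.
rewrite preimage_bigcup setI_bigcupl.
have mDF i : measurable (direction @^-1` F i `&` punctured_ball).
  apply: measurableI; last exact: measurable_punctured_ball.
  by rewrite -[X in measurable X]setTI; exact: measurable_direction.
apply: measure_semi_sigma_additive => //; last exact: bigcupT_measurable.
apply/trivIsetP => /= i j _ _ ij; rewrite setIACA -preimage_setI.
by move/trivIsetP : tF => /(_ _ _ _ _ ij) ->//; rewrite preimage_set0 set0I.
Qed.

HB.instance Definition _ := isMeasure.Build _ _ _ surface_measure
  surface0 surface_ge0 surface_sigma_additive.

End euclidean.

(* Complex-valued functions are differentiated and integrated through their
   real and imaginary parts. *)

Section complex_valued.
Variable R : realType.
Local Notation C := R[i].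

Definition cis (t : R) : C := cos t +i* sin t.

Definition cderive (V : normedModType R) (v : V) (F : V -> C) : V -> C :=
  fun x => 'D_v (fun y => complex.Re (F y)) x
           +i* 'D_v (fun y => complex.Im (F y)) x.

Definition cintegral d (T : measurableType d) (mu : {measure set T -> \bar R})
    (A : set T) (F : T -> C) : C :=
  (\int[mu]_(x in A) complex.Re (F x)) +i* (\int[mu]_(x in A) complex.Im (F x)).

Definition cintegrable d (T : measurableType d) (mu : {measure set T -> \bar R})
    (A : set T) (F : T -> C) : Prop :=
  mu.-integrable A (fun x => (complex.Re (F x))%:E) /\
  mu.-integrable A (fun x => (complex.Im (F x))%:E).

(* On an open subset of a finite-dimensional space this is C^oo: all iterated
   directional derivatives exist and are continuous. *)
Definition smooth_on (V : normedModType R) (U : set V) (f : V -> R) : Prop :=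
  forall (vs : seq V) (x : V), U x ->
    let g := foldr (fun v h => 'D_v h : V -> R) f vs in
    {for x, continuous g} /\ forall v, derivable g x v.

Definition csmooth_on (V : normedModType R) (U : set V) (F : V -> C) : Prop :=
  smooth_on U (fun x => complex.Re (F x)) /\
  smooth_on U (fun x => complex.Im (F x)).

(* The topological dual of the space P of functions T -> C topologized by the
   seminorms p i; the values of L outside P are irrelevant. *)
Definition in_dual (T : Type) (I : eqType) (P : set (T -> C))
    (p : I -> (T -> C) -> \bar R) (L : (T -> C) -> C) : Prop :=
  (forall (c : C) (phi chi : T -> C), P phi -> P chi ->
     L (fun x => c * phi x + chi x) = c * L phi + L chi) /\
  (forall phi0, P phi0 -> forall e : R, 0 < e ->
     exists (J : seq I) (delta : R), 0 < delta /\
       forall phi, P phi ->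
         (forall i, i \in J -> (p i (fun x => phi x - phi0 x)%R < delta%:E)%E) ->
         normc (L phi - L phi0) < e).

End complex_valued.

Section schwartz.
Variables (R : realType) (d : nat).
Local Notation C := R[i].
Local Notation E := 'rV[R]_d.
Local Notation multiindex := {ffun 'I_d -> nat}.
Implicit Types (phi : E -> C) (al be : multiindex).

Definition multi_deriv al phi : E -> C :=
  foldr (fun i h => iter (al i) (cderive (delta_mx ord0 i : E)) h)
    phi (enum 'I_d).

Definition monomial be (x : E) : R := \prod_i x ord0 i ^+ be i.

Definition schwartz_seminorm (ij : multiindex * multiindex) phi : \bar R :=
  ereal_sup [set (`|monomial ij.1 x| * normc (multi_deriv ij.2 phi x))%:E
            | x in [set: E]].

Definition schwartz phi : Prop :=
  csmooth_on setT phi /\ forall ij, (schwartz_seminorm ij phi < +oo)%E.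

Definition lizorkin phi : Prop :=
  schwartz phi /\
  forall be, cintegral (lebesgue_rV R d) setT
               (fun x => (monomial be x)%:C * phi x) = 0.

Definition tempered_distribution : ((E -> C) -> C) -> Prop :=
  in_dual schwartz schwartz_seminorm.

(* Schwartz's space of smooth functions all of whose derivatives are bounded;
   it contains S(R^d). *)
Definition bounded_smooth phi : Prop :=
  csmooth_on setT phi /\
  forall al, exists M : R, forall x, normc (multi_deriv al phi x) <= M.

(* D'_{L^1}(R^d). The distribution sum_j d^{al_j} f_j pairs not only with S(R^d)
   but with every smooth function with bounded derivatives, by the same
   formula. The pairing <f, conj psi_{u,b,a}> requires this, since
   psi_{u,b,a} is constant in the directions orthogonal to u and hence is not in
   S(R^d). *)
Definition DL1 (f : (E -> C) -> C) : Prop :=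
  tempered_distribution f /\
  exists (N : nat) (al : 'I_N -> multiindex) (g : 'I_N -> E -> C),
    (forall j, cintegrable (lebesgue_rV R d) setT (g j)) /\
    forall phi, bounded_smooth phi ->
      f phi = \sum_(j < N) (-1) ^+ (\sum_i al j i)%N *
        cintegral (lebesgue_rV R d) setT
          (fun x => g j x * multi_deriv (al j) phi x).

End schwartz.

(* S_1(R); R is identified with R^1. *)
Definition schwartz1 (R : realType) (psi : R -> R[i]) : Prop :=
  schwartz (fun x : 'rV[R]_1 => psi (x ord0 ord0)) /\
  lizorkin (fun x : 'rV[R]_1 => cis (x ord0 ord0) * psi (x ord0 ord0)).

(* Functions on Y^{n+1} = S^{n-1} x R x R^* are represented by functions on
   R^n x R x R of which only the values on Y^{n+1} matter. *)

Section stockwell.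
Variables (R : realType) (n : nat).
Local Notation C := R[i].
Local Notation E := 'rV[R]_n.
Local Notation EY := (E * R * R)%type.
Implicit Types (Phi : EY -> C) (x u : E) (p : EY).

Definition Y : set EY := [set p | @sphere R n p.1.1 /\ p.2 != 0].

(* The extension of Phi that is homogeneous of degree 0 in the first variable.
   Phi is smooth on the manifold Y iff this extension is smooth on
   (R^n \ 0) x R x R^*, and the Laplace-Beltrami operator of the sphere is the
   Euclidean Laplacian of this extension, restricted to the sphere. *)
Definition radial_ext Phi : EY -> C :=
  fun p => Phi (direction p.1.1, p.1.2, p.2).

Definition smooth_Y Phi : Prop :=
  csmooth_on [set p : EY | p.1.1 != 0 /\ p.2 != 0] (radial_ext Phi).

Definition laplace_beltrami Phi : EY -> C :=
  fun p => \sum_(i < n)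
    let v : EY := (delta_mx ord0 i, 0, 0) in
    cderive v (cderive v (radial_ext Phi)) p.

Definition deriv_b : (EY -> C) -> EY -> C := cderive ((0, 1, 0) : EY).
Definition deriv_a : (EY -> C) -> EY -> C := cderive ((0, 0, 1) : EY).

(* The index is (s, r, l, m, k). *)
Definition Y_seminorm (ix : nat * nat * nat * nat * nat) Phi : \bar R :=
  let: (s, r, l, m, k) := ix in
  ereal_sup [set ((1 + `|p.1.2| ^+ 2) `^ (r%:R / 2)
      * (`|p.2| ^+ s + `|p.2| ^- s)
      * normc (iter l deriv_a (iter m deriv_b (iter k laplace_beltrami Phi)) p))%:E
    | p in Y].

Definition schwartz_Y Phi : Prop :=
  smooth_Y Phi /\ forall ix, (Y_seminorm ix Phi < +oo)%E.

Definition dual_schwartz_Y : ((EY -> C) -> C) -> Prop :=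
  in_dual schwartz_Y Y_seminorm.

Definition integral_Y (F : EY -> C) : C :=
  cintegral (@surface_measure R n) (@sphere R n) (fun u =>
    cintegral lebesgue_measure [set a : R | a != 0] (fun a =>
      cintegral lebesgue_measure [set: R] (fun b =>
        F (u, b, a) * (`|a| ^+ (n - 2))%:C))).

Definition integrable_Y (F : EY -> C) : Prop :=
  cintegrable ((@surface_measure R n \x lebesgue_measure) \x lebesgue_measure)%E
    Y (fun p => F p * (`|p.2| ^+ (n - 2))%:C).

(* psi_{u,b,a} with p = (u, b, a). *)
Definition wavelet (psi : R -> C) p x : C :=
  let: (u, b, a) := p in
  (`|a| / (2 * pi) `^ (n%:R / 2))%:C
  * psi (a * (dotv x u - b)) * cis (a * dotv x u).

Definition synthesis (psi : R -> C) Phi x : C :=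
  integral_Y (fun p => Phi p * wavelet psi p x).

Definition stockwell_dist (psi : R -> C) (f : (E -> C) -> C)
    : (EY -> C) -> C :=
  fun Phi => f (fun x => conjc (synthesis psi (fun p => conjc (Phi p)) x)).

Definition stockwell_fun (psi : R -> C) (f : (E -> C) -> C) : EY -> C :=
  fun p => f (fun x => conjc (wavelet psi p x)).

End stockwell.

(* Main.v *)
(* With chi(s) = e^{is} psi(s), which is a Schwartz function, the wavelet is
   psi_{u,b,a}(x) = c(a,b) chi(a(x.u - b)): all its x-derivatives are bounded by
   powers of |a|, uniformly in x. A test function Phi decays so fast in a and b
   that Phi |a|^m is dominated by a multiple of 1/((1+a^2)(1+b^2)), which is
   integrable over Y^{n+1}. Hence the synthesis integral may be differentiated
   under the integral sign, which gives a smooth function with bounded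
   derivatives, and pairing it with the L^1 functions f_j that represent f amounts,
   by Fubini's theorem, to integrating the pointwise transform against Phi.
   Linearity and continuity of the distributional transform are read off from
   this formula. *)
Require Import Defs.
From HB Require Import structures.
From mathcomp Require Import all_boot all_order all_algebra.
From mathcomp Require Import all_classical all_reals all_analysis.
From mathcomp Require Import measurable_realfun lebesgue_integral_under.
From mathcomp Require Import ring lra.
From mathcomp.real_closed Require Import complex.

Set Implicit Arguments.
Unset Strict Implicit.
Unset Printing Implicit Defensive.
Import Order.TTheory GRing.Theory Num.Theory.
Import numFieldNormedType.Exports.

Local Open Scope classical_set_scope.
Local Open Scope ring_scope.
Local Open Scope complex_scope.

Local Notation normc := ComplexField.Normc.normc.

(** * Integration of complex-valued functions *)

(** A wavelet does not decay along the hyperplanes orthogonal to u, so [f] reaches it only through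
    the functions f_j, and the synthesis integral has to be fed into the same formula. The obstacle
    is to iterate x-derivatives without meeting ever new expressions. Write the conjugate of a
    wavelet as W(p) X_k(s) with s = a(x.u - b), k = 0 and X_k the k-th derivative of the conjugate
    of chi. A derivative in the direction v multiplies W by a(v.u) and raises k by one, so all
    derivatives, of one wavelet or of an integral of wavelets, have closed forms in one family. The
    profile enters only through the bounds of the X_k. Each derivative costs one power of |a|, which
    the decay of the test function repays as |a| grows; near a = 0 the majorant is of order 1 in a
    and boundedness suffices there. *)

Section complex_parts.
Variable R : realType.
Local Notation C := R[i].
Implicit Types x y : C.

Lemma Re_mul x y : complex.Re (x * y) =
  complex.Re x * complex.Re y - complex.Im x * complex.Im y.
Proof. by case: x => a b; case: y => c d. Qed.

Lemma Im_mul x y : complex.Im (x * y) =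
  complex.Re x * complex.Im y + complex.Im x * complex.Re y.
Proof. by case: x => a b; case: y => c d. Qed.

Lemma Re_add x y : complex.Re (x + y) = complex.Re x + complex.Re y.
Proof. by case: x => a b; case: y => c d. Qed.

Lemma Im_add x y : complex.Im (x + y) = complex.Im x + complex.Im y.
Proof. by case: x => a b; case: y => c d. Qed.

Lemma Re_conj x : complex.Re (conjc x) = complex.Re x. Proof. by case: x. Qed.

Lemma Im_conj x : complex.Im (conjc x) = - complex.Im x. Proof. by case: x. Qed.

Lemma complex_eq x y : complex.Re x = complex.Re y ->
  complex.Im x = complex.Im y -> x = y.
Proof. by case: x => a b; case: y => c d /= -> ->. Qed.

Lemma Re_sub x y : complex.Re (x - y) = complex.Re x - complex.Re y.
Proof. by case: x => ? ?; case: y. Qed.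

Lemma Im_sub x y : complex.Im (x - y) = complex.Im x - complex.Im y.
Proof. by case: x => ? ?; case: y. Qed.

Lemma Re_mulE x y : complex.Re (x * y) =
  complex.Re x * complex.Re y + (- complex.Im x) * complex.Im y.
Proof. by rewrite Re_mul mulNr. Qed.

Lemma Im_mulE x y : complex.Im (x * y) =
  complex.Im x * complex.Re y + complex.Re x * complex.Im y.
Proof. by rewrite Im_mul addrC. Qed.

Lemma conj_mul x y : conjc (x * y) = conjc x * conjc y.
Proof.
by apply: complex_eq; rewrite ?(Re_mul, Im_mul, Re_conj, Im_conj); ring.
Qed.

Lemma conj_real (r : R) : conjc r%:C = r%:C.
Proof. by apply: complex_eq; rewrite ?Re_conj ?Im_conj/= ?oppr0. Qed.

Lemma normc_ge0 x : 0 <= normc x.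
Proof. by case: x => a b; exact: sqrtr_ge0. Qed.

Lemma normr_Re_le x : `|complex.Re x| <= normc x.
Proof.
by case: x => a b /=; rewrite -sqrtr_sqr ler_wsqrtr// lerDl sqr_ge0.
Qed.

Lemma normr_Im_le x : `|complex.Im x| <= normc x.
Proof.
by case: x => a b /=; rewrite -sqrtr_sqr ler_wsqrtr// lerDr sqr_ge0.
Qed.

Lemma normc_le x : normc x <= `|complex.Re x| + `|complex.Im x|.
Proof.
case: x => a b /=; rewrite -[leRHS]ger0_norm ?addr_ge0// -sqrtr_sqr.
rewrite ler_wsqrtr// sqrrD !real_normK ?num_real//.
rewrite -addrA lerD2l lerDr.
by rewrite mulrn_wge0// mulr_ge0.
Qed.

Lemma normc_conj x : normc (conjc x) = normc x.
Proof. by case: x => a b /=; rewrite sqrrN. Qed.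

Lemma normc_real (a : R) : normc a%:C = `|a|.
Proof. by rewrite /= expr0n/= addr0 sqrtr_sqr. Qed.

Lemma normc_cis (t : R) : normc (cis t) = 1.
Proof. by rewrite /= cos2Dsin2 sqrtr1. Qed.

Lemma cisD (s t : R) : cis (s + t) = cis s * cis t.
Proof.
by apply: complex_eq; rewrite ?Re_mul ?Im_mul/= ?cosD ?sinD; ring.
Qed.

End complex_parts.

Section cmeasurable.
Context d (T : measurableType d) (R : realType).
Local Notation C := R[i].
Implicit Types (D : set T) (F G : T -> C).

Definition cmeasurable D F :=
  measurable_fun D (fun x => complex.Re (F x)) /\
  measurable_fun D (fun x => complex.Im (F x)).

Lemma cmeasurable_cst D (c : C) : cmeasurable D (fun=> c).
Proof. by split; exact: measurable_cst. Qed.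

Lemma cmeasurable_real D (f : T -> R) :
  measurable_fun D f -> cmeasurable D (fun x => (f x)%:C).
Proof. by move=> mf; split => //=; exact: measurable_cst. Qed.

Lemma cmeasurableD D F G : cmeasurable D F -> cmeasurable D G ->
  cmeasurable D (fun x => F x + G x).
Proof.
move=> [F1 F2] [G1 G2]; split.
- by under eq_fun do rewrite Re_add; exact: measurable_funD.
- by under eq_fun do rewrite Im_add; exact: measurable_funD.
Qed.

Lemma cmeasurableM D F G : cmeasurable D F -> cmeasurable D G ->
  cmeasurable D (fun x => F x * G x).
Proof.
move=> [F1 F2] [G1 G2]; split.
- under eq_fun do rewrite Re_mul.
  by apply: measurable_funB; exact: measurable_funM.
- under eq_fun do rewrite Im_mul.
  by apply: measurable_funD; exact: measurable_funM.
Qed.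

Lemma cmeasurable_conj D F : cmeasurable D F ->
  cmeasurable D (fun x => conjc (F x)).
Proof.
move=> [F1 F2]; split; first by under eq_fun do rewrite Re_conj.
under eq_fun do rewrite Im_conj.
exact: measurableT_comp.
Qed.

Lemma cmeasurable_cis D (f : T -> R) :
  measurable_fun D f -> cmeasurable D (fun x => cis (f x)).
Proof.
by move=> mf; split => /=; apply: measurableT_comp => //;
  apply: continuous_measurable_fun; [exact: continuous_cos|exact: continuous_sin].
Qed.

Lemma cmeasurableS D1 D2 F : measurable D2 -> D1 `<=` D2 ->
  cmeasurable D2 F -> cmeasurable D1 F.
Proof. by move=> mD D12 [F1 F2]; split; exact: (measurable_funS mD D12). Qed.

Lemma cmeasurable_mkcond D F :
  measurable D -> cmeasurable D F ->
  cmeasurable setT (fun x => F x * (\1_D x)%:C).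
Proof.
move=> mD [F1 F2].
have E (h : C -> R) : h 0 = 0 ->
    (fun x => h (F x * (\1_D x)%:C)) = (fun x => h (F x)) \_ D.
  move=> h0; apply/funext => x; rewrite patchE indicE.
  by case: ifP => xD; rewrite ?mulr1 ?mulr0.
by split; rewrite E//; exact/(measurable_restrictT _ mD).1.
Qed.

End cmeasurable.

Lemma cmeasurable_comp d1 d2 (T1 : measurableType d1) (T2 : measurableType d2)
    (R : realType) (F : T2 -> R[i]) (g : T1 -> T2) :
  cmeasurable setT F -> measurable_fun setT g -> cmeasurable setT (F \o g).
Proof.
by move=> [F1 F2] mg; split;
  [exact: (measurableT_comp F1 mg)|exact: (measurableT_comp F2 mg)].
Qed.

Section cintegral.
Context d (T : measurableType d) (R : realType).
Variables (mu : {measure set T -> \bar R}) (D : set T) (mD : measurable D).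
Local Notation C := R[i].
Implicit Types (F G : T -> C) (g : T -> R).

Lemma cintegrable_measurable F : cintegrable mu D F -> cmeasurable D F.
Proof.
by move=> [F1 F2]; split; apply/measurable_EFinP;
  [exact: measurable_int F1|exact: measurable_int F2].
Qed.

Lemma le_cintegrable F g : cmeasurable D F -> mu.-integrable D (EFin \o g) ->
  (forall x, D x -> normc (F x) <= g x) -> cintegrable mu D F.
Proof.
move=> [F1 F2] ig Fg; split; apply: (le_integrable mD _ _ ig).
- exact/measurable_EFinP.
- move=> x Dx; rewrite lee_fin (le_trans (normr_Re_le _))//.
  by rewrite (le_trans (Fg _ Dx))// ler_norm.
- exact/measurable_EFinP.
- move=> x Dx; rewrite lee_fin (le_trans (normr_Im_le _))//.
  by rewrite (le_trans (Fg _ Dx))// ler_norm.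
Qed.

Lemma integrable_normc F : cintegrable mu D F ->
  mu.-integrable D (fun x => (normc (F x))%:E).
Proof.
move=> iF; have [F1 F2] := cintegrable_measurable iF.
have [i1 i2] := iF.
apply: (le_integrable mD _ _
  (integrableD mD (integrable_abse i1) (integrable_abse i2))).
- apply/measurable_EFinP.
  rewrite (_ : (fun x => _) = (fun x =>
      Num.sqrt (complex.Re (F x) ^+ 2 + complex.Im (F x) ^+ 2))).
    apply: (@measurableT_comp _ _ _ _ _ _ (@Num.sqrt R)).
      by apply: continuous_measurable_fun; exact: sqrt_continuous.
    by apply: measurable_funD; exact: measurable_funX.
  by apply/funext => x; case: (F x).
- move=> x Dx /=; rewrite lee_fin ger0_norm ?normc_ge0//.
  by rewrite ger0_norm ?addr_ge0//; exact: normc_le.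
Qed.

Lemma eq_cintegral F G : (forall x, D x -> F x = G x) ->
  cintegral mu D F = cintegral mu D G.
Proof.
by move=> FG; congr (_ +i* _); apply: eq_Rintegral => x /set_mem Dx; rewrite FG.
Qed.

Lemma eq_cintegrable F G : (forall x, D x -> F x = G x) ->
  cintegrable mu D F -> cintegrable mu D G.
Proof.
by move=> FG [F1 F2]; split; [move: F1|move: F2]; apply: eq_integrable => //;
  move=> x /set_mem Dx; rewrite FG.
Qed.

Lemma cintegrableD F G : cintegrable mu D F -> cintegrable mu D G ->
  cintegrable mu D (fun x => F x + G x).
Proof.
move=> [F1 F2] [G1 G2]; split.
- under eq_fun do rewrite Re_add EFinD; exact: integrableD.
- under eq_fun do rewrite Im_add EFinD; exact: integrableD.
Qed.

Lemma cintegralD F G : cintegrable mu D F -> cintegrable mu D G ->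
  cintegral mu D (fun x => F x + G x) = cintegral mu D F + cintegral mu D G.
Proof.
move=> [F1 F2] [G1 G2]; apply: complex_eq; rewrite ?Re_add ?Im_add/=.
- by under eq_Rintegral do rewrite Re_add; rewrite RintegralD.
- by under eq_Rintegral do rewrite Im_add; rewrite RintegralD.
Qed.

Lemma cintegrableZl (c : C) F : cintegrable mu D F ->
  cintegrable mu D (fun x => c * F x).
Proof.
move=> [F1 F2]; split.
- under eq_fun do rewrite Re_mul EFinB !EFinM.
  by apply: integrableB => //; exact: integrableZl.
- under eq_fun do rewrite Im_mul EFinD !EFinM.
  by apply: integrableD => //; exact: integrableZl.
Qed.

Lemma cintegralZl (c : C) F : cintegrable mu D F ->
  cintegral mu D (fun x => c * F x) = c * cintegral mu D F.
Proof.
move=> [F1 F2]; apply: complex_eq; rewrite ?Re_mul ?Im_mul/=.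
- under eq_Rintegral do rewrite Re_mul.
  rewrite RintegralB//; [by rewrite !RintegralZl|
    exact: (integrableZl mD _ F1)|exact: (integrableZl mD _ F2)].
- under eq_Rintegral do rewrite Im_mul.
  rewrite RintegralD//; [by rewrite !RintegralZl|
    exact: (integrableZl mD _ F2)|exact: (integrableZl mD _ F1)].
Qed.

Lemma cintegral_conj F : cintegrable mu D F ->
  cintegral mu D (fun x => conjc (F x)) = conjc (cintegral mu D F).
Proof.
move=> [F1 F2]; apply: complex_eq; rewrite ?Re_conj ?Im_conj/=.
- by under eq_Rintegral do rewrite Re_conj.
- under eq_Rintegral do rewrite Im_conj -mulN1r.
  by rewrite RintegralZl// mulN1r.
Qed.

(** Fubini's theorem is used below on whole spaces only; the factor [\1_D] moves an integral over
    [D] there. *)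
Lemma cintegral_mkcond F :
  cintegral mu D F = cintegral mu setT (fun x => F x * (\1_D x)%:C).
Proof.
have E (h : C -> R) : h 0 = 0 -> (fun x => h (F x)) \_ D =
    (fun x => h (F x * (\1_D x)%:C)).
  move=> h0; apply/funext => x; rewrite patchE indicE.
  by case: ifP => xD; rewrite ?mulr1 ?mulr0.
by rewrite /cintegral !(@Rintegral_mkcond _ _ _ _ D) !E.
Qed.

Lemma cintegrable_mkcond F :
  cintegrable mu D F <-> cintegrable mu setT (fun x => F x * (\1_D x)%:C).
Proof.
have E (h : C -> R) : h 0 = 0 -> (fun x => (h (F x))%:E) \_ D =
    (fun x => (h (F x * (\1_D x)%:C))%:E).
  move=> h0; apply/funext => x; rewrite patchE indicE.
  by case: ifP => xD; rewrite ?mulr1 ?mulr0 ?h0.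
by rewrite /cintegrable !(integrable_mkcond _ mD) !E.
Qed.

(** The factor 2 arises from bounding the real and the imaginary part separately by [g]. *)
Lemma normc_cintegral_le F g : cintegrable mu D F ->
  mu.-integrable D (EFin \o g) -> (forall x, D x -> normc (F x) <= g x) ->
  normc (cintegral mu D F) <= 2 * \int[mu]_(x in D) g x.
Proof.
move=> [F1 F2] ig Fg; apply: le_trans (normc_le _) _.
rewrite mulr_natl mulr2n; apply: lerD => /=.
- apply: le_trans (le_normr_Rintegral mD F1) _; apply: le_Rintegral => //.
    exact: integrable_norm.
  by move=> x Dx; rewrite (le_trans (normr_Re_le _))// Fg.
- apply: le_trans (le_normr_Rintegral mD F2) _; apply: le_Rintegral => //.
    exact: integrable_norm.
  by move=> x Dx; rewrite (le_trans (normr_Im_le _))// Fg.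
Qed.

Lemma cintegrable_sum (I : Type) (s : seq I) (h : I -> T -> C) :
  (forall i, cintegrable mu D (h i)) ->
  cintegrable mu D (fun x => \sum_(i <- s) h i x).
Proof.
move=> ih; elim: s => [|i s IH].
  under eq_fun do rewrite big_nil; split; exact: integrable0.
by under eq_fun do rewrite big_cons; exact: cintegrableD.
Qed.

Lemma cintegral_sum (I : Type) (s : seq I) (h : I -> T -> C) :
  (forall i, cintegrable mu D (h i)) ->
  cintegral mu D (fun x => \sum_(i <- s) h i x) =
  \sum_(i <- s) cintegral mu D (h i).
Proof.
move=> ih; elim: s => [|i s IH].
  rewrite big_nil; under eq_fun do rewrite big_nil.
  apply: complex_eq => /=.
  - by rewrite Rintegral_cst// mul0r.
  - by rewrite Rintegral_cst// mul0r.
rewrite big_cons -IH -cintegralD//; last exact: cintegrable_sum.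
by apply: eq_cintegral => x _; rewrite big_cons.
Qed.

End cintegral.

(** * Fubini's theorem for complex-valued functions *)

Section fubini.
Context d1 d2 (T1 : measurableType d1) (T2 : measurableType d2) (R : realType).
Variable m1 : {sigma_finite_measure set T1 -> \bar R}.
Variable m2 : {sigma_finite_measure set T2 -> \bar R}.
Local Notation C := R[i].

Section real_fubini.
Variable h : T1 * T2 -> R.
Hypothesis ih : (m1 \x m2)%E.-integrable setT (EFin \o h).

(** A real-valued integral is [fine] of an extended one. Integrability of every section, not just of
    almost every one, makes the two agree at each [x], so that the inner integral can be rewritten
    as a function. *)
Lemma Rintegrable_fubini1 :
  (forall x, m2.-integrable setT (fun y => (h (x, y))%:E)) ->
  m1.-integrable setT (fun x => (\int[m2]_y h (x, y))%:E) /\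
  \int[m1]_x \int[m2]_y h (x, y) = \int[(m1 \x m2)%E]_z h z.
Proof.
move=> ihx.
have E : (fun x => (\int[m2]_y h (x, y))%:E) =
    (fun x => \int[m2]_y ((EFin \o h) (x, y)))%E.
  apply/funext => x; rewrite /Rintegral fineK//.
  exact: integrable_fin_num (ihx x).
split; first by rewrite E; exact: integrable_fubini_F.
by rewrite /Rintegral -(integral12_prod_meas1 ih); congr fine; rewrite -E.
Qed.

Lemma Rintegral_fubini2 :
  (forall y, m1.-integrable setT (fun x => (h (x, y))%:E)) ->
  \int[m2]_y \int[m1]_x h (x, y) = \int[(m1 \x m2)%E]_z h z.
Proof.
move=> ihy.
have E : (fun y => (\int[m1]_x h (x, y))%:E) =
    (fun y => \int[m1]_x ((EFin \o h) (x, y)))%E.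
  apply/funext => y; rewrite /Rintegral fineK//.
  exact: integrable_fin_num (ihy y).
by rewrite /Rintegral -(integral21_prod_meas1 ih); congr fine; rewrite -E.
Qed.

End real_fubini.

Variable F : T1 * T2 -> C.
Hypothesis iF : cintegrable (m1 \x m2)%E setT F.

Lemma cintegrable_fubini1 :
  (forall x, cintegrable m2 setT (fun y => F (x, y))) ->
  cintegrable m1 setT (fun x => cintegral m2 setT (fun y => F (x, y))) /\
  cintegral m1 setT (fun x => cintegral m2 setT (fun y => F (x, y))) =
  cintegral (m1 \x m2)%E setT F.
Proof.
move=> ix.
have [R1 R2] := Rintegrable_fubini1 iF.1 (fun x => (ix x).1).
have [I1 I2] := Rintegrable_fubini1 iF.2 (fun x => (ix x).2).
by split; [split|congr (_ +i* _)].
Qed.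

Lemma cintegral_fubini2 :
  (forall y, cintegrable m1 setT (fun x => F (x, y))) ->
  cintegral m2 setT (fun y => cintegral m1 setT (fun x => F (x, y))) =
  cintegral (m1 \x m2)%E setT F.
Proof.
move=> iy.
have R2 := Rintegral_fubini2 iF.1 (fun y => (iy y).1).
have I2 := Rintegral_fubini2 iF.2 (fun y => (iy y).2).
by congr (_ +i* _).
Qed.

End fubini.

Section product_bound.
Context d1 d2 (T1 : measurableType d1) (T2 : measurableType d2) (R : realType).
Variable m1 : {sigma_finite_measure set T1 -> \bar R}.
Variable m2 : {sigma_finite_measure set T2 -> \bar R}.
Local Notation C := R[i].
Variables (g1 : T1 -> R) (g2 : T2 -> R).
Hypotheses (ig1 : m1.-integrable setT (EFin \o g1))
           (ig2 : m2.-integrable setT (EFin \o g2)).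

(** By Tonelli, the integral of the absolute value factors into two finite integrals. *)
Lemma integrable_prod :
  (m1 \x m2)%E.-integrable setT (fun z => (g1 z.1 * g2 z.2)%:E).
Proof.
have mg1 : measurable_fun setT g1 by apply/measurable_EFinP; exact: measurable_int ig1.
have mg2 : measurable_fun setT g2 by apply/measurable_EFinP; exact: measurable_int ig2.
apply/integrable12ltyP.
  apply/measurable_EFinP/measurable_funM.
    exact: (measurableT_comp mg1 measurable_fst).
  exact: (measurableT_comp mg2 measurable_snd).
have f1 := integrable_lty measurableT (integrable_abse ig1).
have f2 : (\int[m2]_y `|(g2 y)%:E| \is a fin_num)%E.
  exact: integrable_fin_num (integrable_abse ig2).
rewrite (_ : (fun x => _) = (fun x => `|(g1 x)%:E| * \int[m2]_y `|(g2 y)%:E|)%E).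
  rewrite -(fineK f2) ge0_integralZr//.
  - rewrite muleC; apply: lte_mul_pinfty => //.
    by rewrite lee_fin fine_ge0// integral_ge0.
  - exact/measurable_EFinP/measurableT_comp.
  - by rewrite lee_fin fine_ge0// integral_ge0.
apply/funext => x; rewrite -ge0_integralZl//.
- by apply: eq_integral => y _ /=; rewrite normrM EFinM.
- exact/measurable_EFinP/measurableT_comp.
Qed.

(** A majorant that is a product and holds everywhere controls the joint integral and each single
    section at once, which is what the preceding form of Fubini's theorem asks for. *)
Lemma cintegrable_prod (F : T1 * T2 -> C) : cmeasurable setT F ->
  (forall x y, normc (F (x, y)) <= g1 x * g2 y) ->
  [/\ cintegrable (m1 \x m2)%E setT F,
      forall x, cintegrable m2 setT (fun y => F (x, y)) &
      forall y, cintegrable m1 setT (fun x => F (x, y))].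
Proof.
move=> mF Fg; split.
- by apply: (le_cintegrable measurableT mF integrable_prod) => -[x y] _; exact: Fg.
- move=> x; apply: (@le_cintegrable _ _ _ _ _ _ _ (fun y => g1 x * g2 y)) => //.
    exact: (cmeasurable_comp mF (pair1_measurable x)).
  exact: (integrableZl measurableT _ ig2).
- move=> y; apply: (@le_cintegrable _ _ _ _ _ _ _ (fun x => g1 x * g2 y)) => //.
    exact: (cmeasurable_comp mF (pair2_measurable y)).
  exact: (integrableZr measurableT _ ig1).
Qed.

Lemma cfubini (F : T1 * T2 -> C) : cmeasurable setT F ->
  (forall x y, normc (F (x, y)) <= g1 x * g2 y) ->
  cintegral m1 setT (fun x => cintegral m2 setT (fun y => F (x, y))) =
  cintegral m2 setT (fun y => cintegral m1 setT (fun x => F (x, y))).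
Proof.
move=> mF Fg; have [iF i2 i1] := cintegrable_prod mF Fg.
by rewrite (cintegrable_fubini1 iF i2).2 (cintegral_fubini2 iF i1).
Qed.

End product_bound.

(** * Measures on R^n, on the sphere and on Y^{n+1} *)

Section lebesgue_rV_sigma_finite.
Variable R : realType.

Definition cube n (r : R) : set 'rV[R]_n := [set x | forall i, `|x ord0 i| <= r].

Lemma measurable_cube n r : measurable (@cube n r).
Proof.
rewrite (_ : cube r = \bigcap_(i in [set: 'I_n])
    (@rV_coord R n i @^-1` `[(- r), r])); last first.
  apply/seteqP; split => [x xr i _|x xr i]/=.
    by rewrite in_itv/= -ler_norml; exact: xr.
  by have := xr i I; rewrite /= in_itv/= -ler_norml.
apply: fin_bigcap_measurable; first exact: finite_finset.
move=> i _; rewrite -[X in measurable X]setTI.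
exact: measurable_rV_coord.
Qed.

(** Induction along the recursive definition of the measure: a cube pulls back under [rV_cons] to
    the product of a smaller cube and an interval. *)
Lemma lebesgue_rV_cube n r : (lebesgue_rV R n (cube r) < +oo)%E.
Proof.
elim: n => [|n IH] /=; first by rewrite diracE ltry.
rewrite /lebesgue_rV_succ /pushforward.
have -> : @rV_cons R n @^-1` cube r = cube r `*` `[(- r), r].
  apply/seteqP; split => [[x t]/= xr|[x t]/= [xr tr] i].
    split; first by move=> i; have := xr (lift ord0 i); rewrite /rV_cons mxE liftK.
    by have := xr ord0; rewrite /rV_cons mxE unlift_none in_itv/= -ler_norml.
  rewrite /rV_cons mxE; case: (unliftP ord0 i) => [j|] _; first exact: xr.
  by move: tr; rewrite in_itv/= -ler_norml.
rewrite product_measure1E//; last exact: measurable_cube.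
rewrite lte_mul_pinfty//.
  by rewrite ge0_fin_numE.
by rewrite /= lebesgue_measure_itv/=; case: ifP => _; rewrite ?ltry.
Qed.

Lemma lebesgue_rV_sigma_finite n : sigma_finite setT (lebesgue_rV R n).
Proof.
exists (fun k => @cube n k%:R).
  apply/esym/seteqP; split => // x _.
  exists (Num.truncn (\sum_i `|x ord0 i|)).+1 => // i.
  apply: ltW; apply: le_lt_trans (truncnS_gt _).
  by rewrite (bigD1 i)//= lerDl sumr_ge0.
by move=> k; split; [exact: measurable_cube|exact: lebesgue_rV_cube].
Qed.

End lebesgue_rV_sigma_finite.

Section with_sigma_finite.
Context d (T : measurableType d) (R : realType).
Variables (mu : {measure set T -> \bar R}) (h : sigma_finite setT mu).

(** The proof is an argument of the alias so that the sigma-finite structure can be attached to it.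
    The alias is convertible with [mu], so statements about one serve for the other. *)
Definition with_sigma_finite of sigma_finite setT mu : set T -> \bar R := mu.
Local Notation nu := (with_sigma_finite h).

HB.instance Definition _ := Measure.on nu.
HB.instance Definition _ := Measure_isSigmaFinite.Build _ _ _ nu h.

Definition sigma_finite_pack : {sigma_finite_measure set T -> \bar R} := nu.

End with_sigma_finite.

(* The library's own sigma-finite instance on [m1 \x m2] is shadowed by the one
   for subprobabilities and is never inferred. *)
Section product_sigma_finite.
Context d1 d2 (T1 : measurableType d1) (T2 : measurableType d2) (R : realType).
Variables (m1 : {sigma_finite_measure set T1 -> \bar R})
          (m2 : {sigma_finite_measure set T2 -> \bar R}).

Lemma sigma_finite_product : sigma_finite setT (m1 \x m2)%E.
Proof.
have /sigma_finiteP[F [TF ndF Foo]] := sigma_finiteT m1.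
have /sigma_finiteP[G [TG ndG Goo]] := sigma_finiteT m2.
exists (fun k => F k `*` G k).
  apply/esym/seteqP; split => // -[x y] _.
  have [i _ Fix] : (\bigcup_i F i) x by rewrite -TF.
  have [j _ Gjy] : (\bigcup_i G i) y by rewrite -TG.
  (* Both exhaustions are nondecreasing, so the larger index serves both coordinates. *)
  exists (maxn i j) => //; split => /=.
  - by move: Fix; apply/subsetPset/ndF; rewrite leq_maxl.
  - by move: Gjy; apply/subsetPset/ndG; rewrite leq_maxr.
move=> k; have [mF Fk] := Foo k; have [mG Gk] := Goo k.
split; first exact: measurableX.
by rewrite product_measure1E// lte_mul_pinfty// ge0_fin_numE.
Qed.

End product_sigma_finite.

Section surface_finite.
Variables (R : realType) (n : nat).

Lemma coord_le_enorm (x : 'rV[R]_n) i : `|x ord0 i| <= enorm x.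
Proof.
rewrite /enorm -sqrtr_sqr ler_wsqrtr// /dotv (bigD1 i)//= -expr2 lerDl.
by rewrite sumr_ge0// => j _; rewrite -expr2 sqr_ge0.
Qed.

Lemma measurable_sphere : measurable (@sphere R n).
Proof.
rewrite (_ : @sphere R n = @enorm R n @^-1` [set 1]); last by [].
by rewrite -[X in measurable X]setTI; exact: measurable_enorm.
Qed.

(** The cone over any set lies in the unit ball, hence in a cube of finite measure. *)
Lemma surface_measure_fin : fin_num_fun (@surface_measure R n).
Proof.
move=> A mA; rewrite ge0_fin_numE//.
have mDA : measurable (@direction R n @^-1` A `&` @punctured_ball R n).
  apply: measurableI; last exact: measurable_punctured_ball.
  by rewrite -[X in measurable X]setTI; exact: measurable_direction.
rewrite /surface_measure; apply: lte_mul_pinfty => //.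
apply: le_lt_trans (lebesgue_rV_cube n 1).
apply: le_measure; rewrite ?inE//; first exact: measurable_cube.
move=> x [_ /andP[_ x1]] i.
exact: le_trans (coord_le_enorm _ _) x1.
Qed.

HB.instance Definition _ := Measure_isFinite.Build _ _ _ (@surface_measure R n)
  surface_measure_fin.

End surface_finite.

Section oneDsqr_integrable.
Variable R : realType.
Local Notation mu := (@lebesgue_measure R).

(** [oneDsqr x] is 1 + x^2. The integral over the half-line is known, and evenness doubles it. *)
Lemma integrable_oneDsqrV : mu.-integrable setT (fun x : R => ((oneDsqr x)^-1)%:E).
Proof.
have cV : continuous (fun x : R => (oneDsqr x)^-1) by exact: continuous_oneDsqrV.
apply/integrableP; split.
  by apply/measurable_EFinP; apply: continuous_measurable_fun.
under eq_integral do rewrite gee0_abs ?lee_fin ?invr_ge0 ?(le_trans _ (oneDsqr_ge1 _))//.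
rewrite ge0_symfun_integralT//.
- have -> : [set x : R | 0 <= x] = `[0, +oo[%classic by rewrite set_itvcy.
  by rewrite integral0y_oneDsqr -EFinM ltry.
- by move=> x; rewrite /oneDsqr/= sqrrN.
Qed.

End oneDsqr_integrable.

(** * The iterated integral over Y^{n+1} as an integral for a product measure *)

Section Y_integral.
Variables (R : realType) (n : nat).
Local Notation C := R[i].
Local Notation E := 'rV[R]_n.
Local Notation EY := (E * R * R)%type.
Local Notation leb := (@lebesgue_measure R).
Local Notation S := (@sphere R n).
Local Notation surf := (@surface_measure R n).

Let surfs : {sigma_finite_measure set E -> \bar R} := surf.
Let surfleb : {sigma_finite_measure set (E * measurableTypeR R)%type -> \bar R} :=
  sigma_finite_pack (sigma_finite_product surfs leb).

Local Notation YT := ((E * measurableTypeR R) * measurableTypeR R)%type.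

Definition Y_measure : {measure set YT -> \bar R} := ((surf \x leb) \x leb)%E.

Lemma measurable_neq0 : measurable [set a : R | a != 0].
Proof.
rewrite (_ : [set a : R | a != 0] = ~` [set 0]).
  exact: measurableC.
by apply/seteqP; split => a /=; [move/eqP|move=> ?; apply/eqP].
Qed.

Lemma measurable_Y : measurable (@Y R n : set YT).
Proof.
rewrite (_ : (@Y R n : set YT) = (S `*` setT) `*` [set a : R | a != 0]).
  apply: measurableX; last exact: measurable_neq0.
  by apply: measurableX => //; exact: measurable_sphere.
by apply/seteqP; split => [[[u b] a]|[[u b] a]] /= [] // [].
Qed.

Definition Y_bound (p : EY) : R :=
  \1_S p.1.1 * (oneDsqr p.1.2)^-1 * (oneDsqr p.2)^-1.

Lemma Y_bound_ge0 p : 0 <= Y_bound p.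
Proof.
by rewrite /Y_bound !mulr_ge0// invr_ge0 (le_trans _ (oneDsqr_ge1 _)).
Qed.

Lemma integrable_sphere_bound :
  (surf \x leb)%E.-integrable setT
    (fun p : E * measurableTypeR R => (\1_S p.1 * (oneDsqr p.2)^-1)%:E).
Proof.
apply: (@integrable_prod _ _ _ _ _ surf leb (\1_S) (fun b => (oneDsqr b)^-1)).
  by apply: integrable_indic; exact: measurable_sphere.
exact: integrable_oneDsqrV.
Qed.

Lemma integrable_Y_bound : Y_measure.-integrable setT (fun p => (Y_bound p)%:E).
Proof.
exact: (@integrable_prod _ _ _ _ _ surfleb leb _
  (fun b => (oneDsqr b)^-1) integrable_sphere_bound (@integrable_oneDsqrV R)).
Qed.

(** The iterated integral takes u, then a, and b innermost, while the product measure orders the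
    variables as u, b, a. Hence Fubini's theorem is applied for the last variable, then for the pair
    (u, b), and a and b are exchanged for fixed u. No sign is assumed for [M], whence [|M|] in the
    majorants. *)
Lemma integral_YE (F : EY -> C) (M : R) :
  let F' p := F p * (`|p.2| ^+ (n - 2))%:C in
  cmeasurable (@Y R n : set YT) F' ->
  (forall p, Y p -> normc (F' p) <= M * Y_bound p) ->
  cintegrable Y_measure (@Y R n) F' /\
  integral_Y F = cintegral Y_measure (@Y R n) F'.
Proof.
move=> F' mF bF.
have mY := measurable_Y.
pose H (p : YT) := F' p * (\1_(@Y R n) p)%:C.
have mH : cmeasurable setT H by exact: cmeasurable_mkcond.
have bH u b a : normc (H (u, b, a)) <=
    `|M| * \1_S u * (oneDsqr b)^-1 * (oneDsqr a)^-1.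
  rewrite /H indicE; have [/set_mem Yp|_] := boolP ((u, b, a) \in @Y R n).
    rewrite mulr1 (le_trans (bF _ Yp))//.
    have := ler_wpM2r (Y_bound_ge0 (u, b, a)) (ler_norm M).
    by rewrite /Y_bound !mulrA.
  rewrite mulr0 (_ : normc 0 = 0); last by rewrite /= expr0n/= addr0 sqrtr0.
  by rewrite !mulr_ge0// invr_ge0 (le_trans _ (oneDsqr_ge1 _)).
have iH : cintegrable Y_measure setT H.
  apply: (le_cintegrable measurableT mH
    (integrableZl measurableT `|M| integrable_Y_bound)) => -[[u b] a] _.
  by rewrite (le_trans (bH u b a))// /Y_bound !mulrA.
have iF : cintegrable Y_measure (@Y R n) F'.
  exact/(cintegrable_mkcond _ mY).
split => //; rewrite (cintegral_mkcond Y_measure).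
have i1 := @integrable_oneDsqrV R.
have i2 : surfleb.-integrable setT (EFin \o
    (fun p : E * measurableTypeR R => `|M| * (\1_S p.1 * (oneDsqr p.2)^-1))).
  exact: (integrableZl measurableT _ integrable_sphere_bound).
have [_ s1 _] : [/\ cintegrable (surfleb \x leb)%E setT H,
    forall p, cintegrable leb setT (fun a => H (p, a)) &
    forall a, cintegrable surfleb setT (fun p => H (p, a))].
  apply: (@cintegrable_prod _ _ _ _ _ surfleb leb _ _ i2 i1 H mH).
  by move=> [u b] a; rewrite mulrA; exact: bH.
have [K1 K2] := @cintegrable_fubini1 _ _ _ _ _ surfleb leb H iH s1.
rewrite -[RHS]K2.
have mHu u : cmeasurable setT
    (fun q : measurableTypeR R * measurableTypeR R => H (u, q.1, q.2)).
  apply: (@cmeasurable_comp _ _ _ _ _ H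
    (fun q : measurableTypeR R * measurableTypeR R => (u, q.1, q.2))) => //.
  by apply: measurable_fun_pair => //; apply: measurable_fun_pair.
have i3 u : leb.-integrable setT
    (EFin \o (fun b : measurableTypeR R => `|M| * \1_S u * (oneDsqr b)^-1)).
  exact: (integrableZl measurableT _ i1).
have c4 u := @cintegrable_prod _ _ _ _ _ leb leb _ _ (i3 u) i1 _ (mHu u) (bH u).
(* The exchange of a and b on the slice above [u]. *)
have c5 u := @cfubini _ _ _ _ _ leb leb _ _ (i3 u) i1 _ (mHu u) (bH u).
have s2 u : cintegrable leb setT (fun b => cintegral leb setT (fun a => H (u, b, a))).
  have [A1 A2 _] := c4 u.
  exact: (@cintegrable_fubini1 _ _ _ _ _ leb leb _ A1 A2).1.
rewrite -[RHS](@cintegrable_fubini1 _ _ _ _ _ surfs leb _ K1 s2).2.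
rewrite /integral_Y cintegral_mkcond; apply: eq_cintegral => u _.
rewrite [RHS]c5 [X in X * _]cintegral_mkcond/=.
have cint0 : cintegral leb setT (fun=> 0 : C) = 0.
  by apply: complex_eq => /=; rewrite Rintegral_cst// mul0r.
(* The domains of the iterated integral have become indicators. Off the sphere, and below at a = 0,
   [H] vanishes and both sides are 0. *)
have [uS|uS] := boolP (u \in S); last first.
  rewrite indicE (negbTE uS) mulr0; apply/esym.
  rewrite -[RHS]cint0; apply: eq_cintegral => a _.
  rewrite -[RHS]cint0; apply: eq_cintegral => b _.
  rewrite /H indicE (_ : _ \in _ = false) ?mulr0//.
  by apply/negbTE; apply: contra uS => /set_mem[+ _]; rewrite inE.
rewrite indicE uS mulr1; apply: eq_cintegral => a _.
have [a0|a0] := eqVneq a 0.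
  rewrite indicE (_ : _ \in _ = false) ?mulr0; last first.
    by apply/negbTE/negP => /set_mem/=; rewrite a0 eqxx.
  rewrite -[LHS]cint0; apply: eq_cintegral => b _.
  rewrite /H indicE (_ : _ \in _ = false) ?mulr0//.
  by apply/negbTE/negP => /set_mem[_]/=; rewrite a0 eqxx.
rewrite indicE mem_set// mulr1; apply: eq_cintegral => b _.
rewrite /H indicE mem_set ?mulr1//; split => //=.
exact: set_mem.
Qed.

End Y_integral.

Section rV_norm.
Variables (R : realType) (n : nat).
Implicit Types x y : 'rV[R]_n.

Lemma normr_rV_le x (e : R) : 0 <= e -> (forall i, `|x ord0 i| <= e) -> `|x| <= e.
Proof.
move=> e0 xe; rewrite [leLHS]/Num.norm/= mx_normrE; apply: bigmax_le => //.
by move=> [i j] _ /=; rewrite (ord1 i).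
Qed.

Lemma normr_coord_le x i : `|x ord0 i| <= `|x|.
Proof.
rewrite [leRHS]/Num.norm/= mx_normrE; apply/bigmax_geP; right => /=.
by exists (ord0, i).
Qed.

End rV_norm.

(* A function on R^n x R x R that is continuous at every point of a set is on
   that set the pointwise limit of its compositions with the projections
   onto the grids of mesh 1/k, which take countably many values. *)
Section continuous_measurable_rV.
Variables (R : realType) (n : nat).
Local Notation E := 'rV[R]_n.
Local Notation EY := (E * R * R)%type.
Local Notation YT := ((E * measurableTypeR R) * measurableTypeR R)%type.
Local Notation Z := {ffun 'I_n -> int}.

Let idx (k : nat) (t : R) : int := Num.floor (k.+1%:R * t).
Let pt (k : nat) (z : int) : R := z%:~R / k.+1%:R.

Let pt_idx k t : `|t - pt k (idx k t)| <= k.+1%:R^-1.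
Proof.
have k0 : 0 < k.+1%:R :> R by [].
have /andP[h1 h2] := floor_itv (k.+1%:R * t).
rewrite ger0_norm /pt /idx.
  rewrite lerBlDr -(ler_pM2r k0) mulrDl mulVf ?gt_eqF// divfK ?gt_eqF//.
  by rewrite mulrC addrC; apply: ltW; move: h2; rewrite intrD.
by rewrite subr_ge0 ler_pdivrMr// [leRHS]mulrC.
Qed.

Let gidx k (p : EY) : Z * int * int :=
  ([ffun i => idx k (p.1.1 ord0 i)], idx k p.1.2, idx k p.2).
Let gpt k (z : Z * int * int) : EY :=
  (\row_i pt k (z.1.1 i), pt k z.1.2, pt k z.2).

Let gpt_gidx k p : `|p - gpt k (gidx k p)| <= k.+1%:R^-1.
Proof.
have k0 : 0 <= k.+1%:R^-1 :> R by rewrite invr_ge0.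
case: p => [[u b] a]; rewrite !prod_normE/= !ge_max !pt_idx !andbT.
by apply: normr_rV_le => // i; rewrite !mxE ffunE pt_idx.
Qed.

Let measurable_idx k z : measurable (idx k @^-1` [set z] : set (measurableTypeR R)).
Proof.
rewrite (_ : _ @^-1` _ = ( *%R k.+1%:R) @^-1` `[z%:~R, (z + 1)%:~R[).
  rewrite -[X in measurable X]setTI.
  have : measurable_fun setT ( *%R (k.+1%:R : R)) by exact: measurable_funM.
  exact.
apply/seteqP; split => t /=; rewrite in_itv/=.
  by move=> <-; exact: floor_itv.
by move=> h; apply/eqP; rewrite /idx floor_eq.
Qed.

Let measurable_gidx k z : measurable (gidx k @^-1` [set z] : set YT).
Proof.
case: z => [[z1 z2] z3].
rewrite (_ : _ @^-1` _ = ((\bigcap_(i in [set: 'I_n])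
    (@rV_coord R n i @^-1` (idx k @^-1` [set z1 i]))) `*`
  (idx k @^-1` [set z2])) `*` (idx k @^-1` [set z3])).
  apply: measurableX => //; apply: measurableX => //.
  apply: fin_bigcap_measurable; first exact: finite_finset.
  move=> i _; rewrite -[X in measurable X]setTI.
  exact: measurable_rV_coord.
apply/seteqP; split => [[[u b] a]|[[u b] a]] /=.
  by move=> [<- <- <-]; split => //; split => // i _ /=; rewrite ffunE.
move=> [[h <-] <-]; congr (_, _, _); apply/ffunP => i; rewrite ffunE.
exact: h.
Qed.

Lemma continuous_measurable_fun_rV (D : set EY) (F : EY -> R) :
  (forall p, D p -> {for p, continuous F}) ->
  measurable_fun (D : set YT) (F : YT -> R).
Proof.
move=> cF.
apply: (@measurable_fun_cvg _ _ _ _ (fun k => F \o (gpt k \o gidx k))).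
  move=> k; apply: (@measurable_funS _ _ _ _ setT) => // _ B mB; rewrite setTI.
  (* The composite factors through the countable type of grid indices, so a preimage is a countable
     union of cells whatever the values of [F] at the grid points. *)
  rewrite (_ : _ @^-1` B = \bigcup_(z in [set: Z * int * int])
      (if z \in (F \o gpt k) @^-1` B then gidx k @^-1` [set z] else set0)).
    apply: countable_bigcupT_measurable; first exact: countableP.
    by move=> z; case: ifP => _ //; exact: measurable_gidx.
  apply/seteqP; split => p /=.
    by move=> h; exists (gidx k p) => //; rewrite mem_set.
  by move=> [z _]; case: ifPn => // /set_mem/= h ->.
move=> p Dp.
have gp : (fun k => gpt k (gidx k (p : EY))) @ \oo --> (p : EY).
  apply/cvgrPdist_lt => e e0; near=> k.
  apply: le_lt_trans (gpt_gidx k p) _; near: k.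
  exact: (near_infty_natSinv_lt (PosNum e0)).
exact: cvg_comp gp (cF _ Dp).
Unshelve. all: by end_near. Qed.

End continuous_measurable_rV.

(** * Ridge functions and their superpositions *)

Section line_derivative.
Variables (R : realType) (V : normedModType R).

(** Brings a directional derivative to one real variable, where the chain rule and differentiation
    under the integral sign are applied. *)
Lemma is_derive_line (f : V -> R) x v (l : R) :
  is_derive x v f l <-> is_derive (0 : R) 1 (fun h : R => f (h *: v + x)) l.
Proof.
have E : (fun h : R => h^-1 *: (((fun h : R => f (h *: v + x)) \o shift 0) (h *: 1) -
      f (0 *: v + x))) = (fun h => h^-1 *: ((f \o shift x) (h *: v) - f x)).
  by apply/funext => h /=; rewrite scale0r add0r addr0 [h *: 1]mulr1.
by split=> -[d e]; split; move: d e; rewrite /derivable /derive E.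
Qed.

End line_derivative.

Section profile.
Variable R : realType.
Local Notation C := R[i].

(** A function with its successive derivatives, all bounded, listed as a sequence so that
    differentiating shifts the index. *)
Definition bounded_profile (X : nat -> R -> C) : Prop :=
  [/\ forall k (t : R),
        is_derive t 1 (fun s => complex.Re (X k s)) (complex.Re (X k.+1 t)),
      forall k (t : R),
        is_derive t 1 (fun s => complex.Im (X k s)) (complex.Im (X k.+1 t)) &
      forall k, exists M, forall t, normc (X k t) <= M].

Lemma bounded_derive_lipschitz (f df : R -> R) (M : R) :
  (forall t : R, is_derive t 1 f (df t)) -> (forall t, `|df t| <= M) ->
  forall s t, `|f s - f t| <= M * `|s - t|.
Proof.
move=> fdf dfM.
have cf : continuous f.
  move=> t; apply: differentiable_continuous; apply/derivable1_diffP.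
  exact: (@ex_derive _ _ _ _ _ _ _ (fdf t)).
have H s t : t <= s -> `|f s - f t| <= M * `|s - t|.
  move=> ts.
  have [x _ ->] := MVT_segment ts (fun x _ => fdf x)
    (continuous_subspaceT cf).
  by rewrite normrM ler_wpM2r.
move=> s t; have [ts|st] := leP t s; first exact: H.
by rewrite distrC (distrC s t); apply: H; exact: ltW.
Qed.

Lemma normc_sub_lipschitz (X : nat -> R -> C) : bounded_profile X ->
  forall k, exists2 M, 0 <= M & forall s t, normc (X k s - X k t) <= M * `|s - t|.
Proof.
move=> [X1 X2 XM] k; have [M HM] := XM k.+1.
have M0 : 0 <= M by apply: le_trans (HM 0); exact: normc_ge0.
exists (M + M); first by rewrite addr_ge0.
move=> s t; apply: le_trans (normc_le _) _; rewrite mulrDl; apply: lerD.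
- rewrite Re_sub; apply: (bounded_derive_lipschitz (X1 k)) => r.
  exact: le_trans (normr_Re_le _) (HM _).
- rewrite Im_sub; apply: (bounded_derive_lipschitz (X2 k)) => r.
  exact: le_trans (normr_Im_le _) (HM _).
Qed.

Lemma profile_continuous (X : nat -> R -> C) k : bounded_profile X ->
  continuous (fun t => complex.Re (X k t)) /\
  continuous (fun t => complex.Im (X k t)).
Proof.
move=> [X1 X2 _]; split=> t; apply: differentiable_continuous;
  apply/derivable1_diffP.
- exact: (@ex_derive _ _ _ _ _ _ _ (X1 k t)).
- exact: (@ex_derive _ _ _ _ _ _ _ (X2 k t)).
Qed.

End profile.

(* The derivatives of both a wavelet and of a superposition of wavelets stay in
   a family [F W k] of the following kind, in which a derivative in the
   direction v multiplies the weight W by [dirweight v]. *)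
Section derivative_family.
Variables (R : realType) (n : nat).
Local Notation C := R[i].
Local Notation E := 'rV[R]_n.
Local Notation EY := (E * R * R)%type.
Local Notation multiindex := {ffun 'I_n -> nat}.

Definition dirweight (v : E) (W : EY -> C) : EY -> C :=
  fun p => (p.2 * dotv v p.1.1)%:C * W p.

(** This multiplies [W] by the monomial with exponents [al] in the vector a u. The nesting copies
    that of [multi_deriv], so that one induction treats both. *)
Definition multiweight (al : multiindex) (W : EY -> C) : EY -> C :=
  foldr (fun i W' => iter (al i) (dirweight (delta_mx ord0 i)) W') W (enum 'I_n).

Definition mi_order (al : multiindex) : nat := (\sum_i al i)%N.

(** [good] delimits the weights that may be differentiated: all of them for a single wave, the
    rapidly decreasing ones for a superposition. *)
Variables (good : (EY -> C) -> Prop) (F : (EY -> C) -> nat -> E -> C).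
Hypotheses
  (good_dirweight : forall v W, good W -> good (dirweight v W))
  (F_Re : forall W k x v, good W ->
    is_derive x v (fun y => complex.Re (F W k y))
      (complex.Re (F (dirweight v W) k.+1 x)))
  (F_Im : forall W k x v, good W ->
    is_derive x v (fun y => complex.Im (F W k y))
      (complex.Im (F (dirweight v W) k.+1 x)))
  (F_cont : forall W k, good W ->
    continuous (fun y => complex.Re (F W k y)) /\
    continuous (fun y => complex.Im (F W k y)))
  (F_bnd : forall W k, good W -> exists M, forall x, normc (F W k x) <= M).

Let cderiveF W k v : good W -> cderive v (F W k) = F (dirweight v W) k.+1.
Proof.
move=> gW; apply/funext => x; apply: complex_eq => /=.
- exact: (@derive_val _ _ _ _ _ _ _ (F_Re k x v gW)).
- exact: (@derive_val _ _ _ _ _ _ _ (F_Im k x v gW)).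
Qed.

Let iter_dirweight W v c : good W -> good (iter c (dirweight v) W).
Proof. by move=> gW; elim: c => //= c IH; exact: good_dirweight. Qed.

Lemma good_multiweight W al : good W -> good (multiweight al W).
Proof.
rewrite /multiweight => gW; elim: (enum _) => //= i s IH.
exact: iter_dirweight.
Qed.

Lemma multi_deriv_family W k al : good W ->
  multi_deriv al (F W k) = F (multiweight al W) (mi_order al + k).
Proof.
rewrite /multi_deriv /multiweight /mi_order => gW.
rewrite -(big_enum _ _ _ al) /=.
have : good (foldr (fun i W' => iter (al i) (dirweight (delta_mx ord0 i)) W') W
  (enum 'I_n)) by exact: good_multiweight.
elim: (enum 'I_n) => [|i s IH]/=; first by rewrite big_nil.
move=> _; have gs : good (foldr (fun i W' =>
    iter (al i) (dirweight (delta_mx ord0 i)) W') W s).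
  by elim: s {IH} => //= j s IH; exact: iter_dirweight.
rewrite IH// big_cons -addnA; move: (foldr _ W s) gs (_ + k)%N => W' gW' m.
elim: (al i) => //= c ->.
rewrite cderiveF ?addSn//; exact: iter_dirweight.
Qed.

Lemma bounded_smooth_family W k : good W -> bounded_smooth (F W k).
Proof.
move=> gW; split; last first.
  move=> al; rewrite multi_deriv_family//; apply: F_bnd.
  exact: good_multiweight.
(* Every iterated directional derivative is again a member of the family, the same one for the real
   and the imaginary part. *)
have H vs : exists W' k', good W' /\
    (foldr (fun v h => 'D_v h : E -> R) (fun x => complex.Re (F W k x)) vs =
     fun x => complex.Re (F W' k' x)) /\
    (foldr (fun v h => 'D_v h : E -> R) (fun x => complex.Im (F W k x)) vs =
     fun x => complex.Im (F W' k' x)).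
  elim: vs => [|v vs [W' [k' [gW' [IH1 IH2]]]]] /=; first by exists W, k.
  exists (dirweight v W'), k'.+1; rewrite -cderiveF//; split.
    exact: good_dirweight.
  by rewrite IH1 IH2.
split=> vs x _ /=; have [W' [k' [gW' [e1 e2]]]] := H vs;
  rewrite ?e1 ?e2; split.
- exact: (F_cont k' gW').1.
- by move=> v; exact: (@ex_derive _ _ _ _ _ _ _ (F_Re k' x v gW')).
- exact: (F_cont k' gW').2.
- by move=> v; exact: (@ex_derive _ _ _ _ _ _ _ (F_Im k' x v gW')).
Qed.

End derivative_family.

Section dot_product.
Variables (R : realType) (n : nat).
Implicit Types x y u v : 'rV[R]_n.

Lemma dotv_line h v x u : dotv (h *: v + x) u = h * dotv v u + dotv x u.
Proof.
rewrite /dotv mulr_sumr -big_split/=; apply: eq_bigr => i _.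
by rewrite !mxE mulrDl mulrA.
Qed.

Lemma dotvB x y u : dotv x u - dotv y u = dotv (x - y) u.
Proof.
rewrite /dotv -sumrB; apply: eq_bigr => i _.
by rewrite !mxE mulrBl.
Qed.

Lemma normr_dotv_le x u : `|dotv x u| <= (\sum_i `|u ord0 i|) * `|x|.
Proof.
apply: le_trans (ler_norm_sum _ _ _) _; rewrite mulr_suml.
apply: ler_sum => i _; rewrite normrM mulrC ler_wpM2l//.
exact: normr_coord_le.
Qed.

(** The norm of [x] is the sup norm and each coordinate of [u] is at most 1 in absolute value,
    whence the factor [n]. *)
Lemma normr_dotv_sphere x u : @sphere R n u -> `|dotv x u| <= n%:R * `|x|.
Proof.
move=> Su; apply: le_trans (normr_dotv_le _ _) _; rewrite ler_wpM2r//.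
apply: (@le_trans _ _ (\sum_(i < n) 1)); last by rewrite sumr_const card_ord.
by apply: ler_sum => i _; rewrite -Su coord_le_enorm.
Qed.

Lemma measurable_dotv d (T : measurableType d) (f g : T -> 'rV[R]_n) :
  measurable_fun setT f -> measurable_fun setT g ->
  measurable_fun setT (fun t => dotv (f t) (g t)).
Proof.
move=> mf mg; apply: measurable_sum => i; apply: measurable_funM.
- exact: (measurableT_comp (@measurable_rV_coord R n i) mf).
- exact: (measurableT_comp (@measurable_rV_coord R n i) mg).
Qed.

End dot_product.

Lemma lipschitz_continuous (R : realType) (V : normedModType R) (f : V -> R) L :
  0 <= L -> (forall x y, `|f x - f y| <= L * `|x - y|) -> continuous f.
Proof.
move=> L0 fL x; apply/cvgrPdist_lt => e e0.
(* The summand 1 keeps the divisor positive when [L] is 0. *)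
have d0 : 0 < e / (L + 1) by rewrite divr_gt0// ltr_wpDl.
near=> y; apply: le_lt_trans (fL _ _) _.
have xy : `|x - y| < e / (L + 1).
  by near: y; apply: cvgr_dist_lt d0; exact: cvg_id.
move: xy; rewrite ltr_pdivlMr ?ltr_wpDl// mulrC => /(le_lt_trans _); apply.
by rewrite ler_wpM2r// lerDl.
Unshelve. all: by end_near. Qed.

(** * Single ridge waves *)

Section ridge.
Variables (R : realType) (n : nat).
Local Notation C := R[i].
Local Notation E := 'rV[R]_n.
Local Notation EY := (E * R * R)%type.
Local Notation YT := ((E * measurableTypeR R) * measurableTypeR R)%type.
Local Notation nu := (@Y_measure R n).

Definition ridge (x : E) (p : EY) : R := p.2 * (dotv x p.1.1 - p.1.2).

Lemma measurable_ridge d (T : measurableType d) (f : T -> E) (g : T -> YT) :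
  measurable_fun setT f -> measurable_fun setT g ->
  measurable_fun setT (fun t => ridge (f t) (g t) : measurableTypeR R).
Proof.
move=> mf mg; apply: measurable_funM; first exact: (measurableT_comp _ mg).
apply: measurable_funB.
  apply: measurable_dotv => //.
  by apply: (measurableT_comp _ (measurableT_comp _ mg)).
by apply: (measurableT_comp _ (measurableT_comp _ mg)).
Qed.

Lemma ridge_lipschitz x y p :
  `|ridge x p - ridge y p| <= `|p.2| * (\sum_i `|p.1.1 ord0 i|) * `|x - y|.
Proof.
rewrite (_ : _ - _ = p.2 * dotv (x - y) p.1.1); last first.
  by rewrite -dotvB /ridge; ring.
by rewrite normrM -mulrA ler_wpM2l// normr_dotv_le.
Qed.

Variable X : nat -> R -> C.
Hypothesis HX : bounded_profile X.

(** Along a line the argument of the profile is affine with slope a(v.u). The derivative is needed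
    at every [h], because differentiation under the integral works on an interval. *)
Lemma is_derive_ridge (al be : R) k x v p (h : R) :
  is_derive h 1
    (fun h : R => al * complex.Re (X k (ridge (h *: v + x) p)) +
                  be * complex.Im (X k (ridge (h *: v + x) p)))
    (p.2 * dotv v p.1.1 *
     (al * complex.Re (X k.+1 (ridge (h *: v + x) p)) +
      be * complex.Im (X k.+1 (ridge (h *: v + x) p)))).
Proof.
have [X1 X2 _] := HX.
pose s := p.2 * dotv v p.1.1.
pose l (h : R) : R := h * s + ridge x p.
have E h' : ridge (h' *: v + x) p = l h'.
  by rewrite /l /ridge dotv_line /s; ring.
have dl : is_derive h 1 l s.
  have -> : s = s + 0 by rewrite addr0.
  apply: is_deriveD.
  have := @is_deriveZ _ _ _ (@id R) s h 1 1 (is_derive_id _ _).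
  rewrite (_ : s \*: id = (fun h => h * s)).
    by rewrite (_ : s *: 1 = s)//; exact: mulr1.
  by apply/funext => t /=; exact: mulrC.
have d1 := is_deriveZ al (is_derive1_comp (X1 k (l h)) dl).
have d2 := is_deriveZ be (is_derive1_comp (X2 k (l h)) dl).
have d12 := is_deriveD d1 d2.
under eq_fun do rewrite E.
rewrite !E -/s; apply: (is_derive_eq d12).
by rewrite /GRing.scale/=; ring.
Qed.

Let is_derive_ridge0 (al be : R) k x v p :
  is_derive x v
    (fun y => al * complex.Re (X k (ridge y p)) + be * complex.Im (X k (ridge y p)))
    (p.2 * dotv v p.1.1 *
     (al * complex.Re (X k.+1 (ridge x p)) + be * complex.Im (X k.+1 (ridge x p)))).
Proof.
apply/is_derive_line; have := is_derive_ridge al be k x v p 0.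
by rewrite scale0r add0r.
Qed.

Lemma Re_dirweight v W (p : EY) (z : C) : complex.Re (dirweight v W p * z) =
  p.2 * dotv v p.1.1 *
  (complex.Re (W p) * complex.Re z + (- complex.Im (W p)) * complex.Im z).
Proof. by rewrite Re_mul /dirweight Re_mul Im_mul/=; ring. Qed.

Lemma Im_dirweight v W (p : EY) (z : C) : complex.Im (dirweight v W p * z) =
  p.2 * dotv v p.1.1 *
  (complex.Im (W p) * complex.Re z + complex.Re (W p) * complex.Im z).
Proof. by rewrite Im_mul /dirweight Re_mul Im_mul/=; ring. Qed.

Definition ridge_wave (p : EY) (W : EY -> C) k : E -> C :=
  fun x => W p * X k (ridge x p).

Lemma Re_ridge_wave_derive p W k x v : is_derive x v
  (fun y => complex.Re (ridge_wave p W k y))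
  (complex.Re (ridge_wave p (dirweight v W) k.+1 x)).
Proof.
rewrite /ridge_wave Re_dirweight; under eq_fun do rewrite Re_mulE.
exact: is_derive_ridge0.
Qed.

Lemma Im_ridge_wave_derive p W k x v : is_derive x v
  (fun y => complex.Im (ridge_wave p W k y))
  (complex.Im (ridge_wave p (dirweight v W) k.+1 x)).
Proof.
rewrite /ridge_wave Im_dirweight; under eq_fun do rewrite Im_mulE.
exact: is_derive_ridge0.
Qed.

(** [M] is the same for all [p], so that the estimate can be integrated over [p]. *)
Lemma ridge_wave_lipschitz W k : exists2 M, 0 <= M & forall p x y,
  normc (ridge_wave p W k x - ridge_wave p W k y) <=
  M * (normc (W p) * `|p.2| * \sum_i `|p.1.1 ord0 i|) * `|x - y|.
Proof.
have [M M0 HM] := normc_sub_lipschitz HX k.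
exists M => // p x y; rewrite /ridge_wave -mulrBr ComplexField.Normc.normcM.
apply: le_trans (ler_wpM2l (normc_ge0 _) (HM _ _)) _.
rewrite [leLHS]mulrA.
apply: le_trans (ler_wpM2l (mulr_ge0 (normc_ge0 _) M0) (ridge_lipschitz x y p)) _.
by rewrite le_eqVlt; apply/orP; left; apply/eqP; ring.
Qed.

Lemma clipschitz_continuous (f : E -> C) L : 0 <= L ->
  (forall x y, normc (f x - f y) <= L * `|x - y|) ->
  continuous (fun x => complex.Re (f x)) /\ continuous (fun x => complex.Im (f x)).
Proof.
move=> L0 fL; split; apply: (lipschitz_continuous L0) => x y.
- by rewrite -Re_sub; exact: le_trans (normr_Re_le _) (fL _ _).
- by rewrite -Im_sub; exact: le_trans (normr_Im_le _) (fL _ _).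
Qed.

Lemma ridge_wave_continuous p W k :
  continuous (fun y => complex.Re (ridge_wave p W k y)) /\
  continuous (fun y => complex.Im (ridge_wave p W k y)).
Proof.
have [M M0 HM] := ridge_wave_lipschitz W k.
apply: clipschitz_continuous (HM p).
by rewrite !mulr_ge0 ?normc_ge0// sumr_ge0.
Qed.

Lemma ridge_wave_bounded p W k :
  exists M, forall x, normc (ridge_wave p W k x) <= M.
Proof.
have [_ _ XM] := HX; have [M HM] := XM k.
exists (normc (W p) * M) => x.
by rewrite ComplexField.Normc.normcM ler_wpM2l// normc_ge0.
Qed.

Lemma bounded_smooth_ridge_wave p W k : bounded_smooth (ridge_wave p W k).
Proof.
apply: (@bounded_smooth_family _ _ (fun=> True)) => //.
- by move=> *; exact: Re_ridge_wave_derive.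
- by move=> *; exact: Im_ridge_wave_derive.
- by move=> *; exact: ridge_wave_continuous.
- by move=> *; exact: ridge_wave_bounded.
Qed.

Lemma multi_deriv_ridge_wave p W k al : multi_deriv al (ridge_wave p W k) =
  ridge_wave p (multiweight al W) (mi_order al + k).
Proof.
apply: (@multi_deriv_family _ _ (fun=> True)) => //.
- by move=> *; exact: Re_ridge_wave_derive.
- by move=> *; exact: Im_ridge_wave_derive.
Qed.

End ridge.

(** * Superpositions of ridge waves *)

Section superposition.
Variables (R : realType) (n : nat).
Local Notation C := R[i].
Local Notation E := 'rV[R]_n.
Local Notation EY := (E * R * R)%type.
Local Notation YT := ((E * measurableTypeR R) * measurableTypeR R)%type.
Local Notation nu := (@Y_measure R n).
Local Notation YS := (@Y R n : set YT).

(** Asking for all powers of |a| makes the class stable under [dirweight], which costs one power. *)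
Definition rapid (W : EY -> C) : Prop := cmeasurable YS W /\
  forall m, exists M, forall p, Y p -> normc (W p) * `|p.2| ^+ m <= M * Y_bound p.

Lemma integrable_Y_boundM (M : R) :
  nu.-integrable YS (EFin \o (fun p => M * Y_bound p)).
Proof.
apply: (integrableS measurableT (@measurable_Y R n)) => //.
exact: (integrableZl measurableT _ (@integrable_Y_bound R n)).
Qed.

Lemma rapid_integrable W : rapid W -> cintegrable nu YS W.
Proof.
move=> [mW /(_ 0%N)[M HM]].
apply: (le_cintegrable (@measurable_Y R n) mW (integrable_Y_boundM M)) => p Yp.
by have := HM p Yp; rewrite expr0 mulr1.
Qed.

Lemma cmeasurable_dirweight v (W : EY -> C) :
  cmeasurable YS W -> cmeasurable YS (dirweight v W).
Proof.
move=> mW; apply: cmeasurableM => //; apply: cmeasurable_real.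
apply: measurable_funTS; apply: measurable_funM; first exact: measurable_snd.
apply: measurable_dotv => //.
exact: (measurableT_comp measurable_fst measurable_fst).
Qed.

Lemma normc_dirweight v W (p : EY) : Y p ->
  normc (dirweight v W p) <= n%:R * `|v| * (normc (W p) * `|p.2|).
Proof.
move=> [Su _]; rewrite ComplexField.Normc.normcM normc_real normrM.
rewrite [leRHS](_ : _ = `|p.2| * (n%:R * `|v|) * normc (W p)); last by ring.
by rewrite ler_wpM2r ?normc_ge0// ler_wpM2l// normr_dotv_sphere.
Qed.

Lemma rapid_dirweight v W : rapid W -> rapid (dirweight v W).
Proof.
move=> [mW rW]; split; first exact: cmeasurable_dirweight.
move=> m; have [M HM] := rW m.+1; exists (n%:R * `|v| * M) => p Yp.
apply: le_trans (ler_wpM2r (exprn_ge0 _ (normr_ge0 _)) (normc_dirweight _ _ Yp)) _.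
rewrite -!mulrA ler_wpM2l// ler_wpM2l//.
by have := HM p Yp; rewrite exprS.
Qed.

Variable X : nat -> R -> C.
Hypothesis HX : bounded_profile X.

Lemma cmeasurable_profile_ridge d (T : measurableType d) (f : T -> E) (g : T -> YT) k :
  measurable_fun setT f -> measurable_fun setT g ->
  cmeasurable setT (fun t => X k (ridge (f t) (g t))).
Proof.
move=> mf mg; have [c1 c2] := profile_continuous k HX.
have mr := measurable_ridge mf mg.
split.
- exact: (measurableT_comp (continuous_measurable_fun c1) mr).
- exact: (measurableT_comp (continuous_measurable_fun c2) mr).
Qed.

Lemma cintegrable_ridge_wave W k x : rapid W ->
  cintegrable nu YS (fun p => ridge_wave X p W k x).
Proof.
move=> rW; have [_ _ XM] := HX; have [M HM] := XM k.
have iW := integrable_normc (@measurable_Y R n) (rapid_integrable rW).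
apply: (@le_cintegrable _ _ _ _ _ (@measurable_Y R n) _ (fun p => M * normc (W p))).
- apply: cmeasurableM; first exact: rW.1.
  apply: (cmeasurableS measurableT (@subsetT _ _)).
  exact: cmeasurable_profile_ridge.
- exact: (integrableZl (@measurable_Y R n) _ iW).
- move=> p _; rewrite ComplexField.Normc.normcM mulrC.
  by rewrite ler_wpM2r ?normc_ge0.
Qed.

Definition superposition (W : EY -> C) k : E -> C :=
  fun x => cintegral nu YS (fun p => ridge_wave X p W k x).

Lemma superposition_bounded W k : rapid W ->
  exists M, forall x, normc (superposition W k x) <= M.
Proof.
move=> rW; have [_ _ XM] := HX; have [M HM] := XM k.
have iW := integrable_normc (@measurable_Y R n) (rapid_integrable rW).
exists (2 * \int[nu]_(p in YS) (M * normc (W p))) => x.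
apply: (normc_cintegral_le (@measurable_Y R n)).
- exact: cintegrable_ridge_wave.
- exact: (integrableZl (@measurable_Y R n) _ iW).
- move=> p _; rewrite ComplexField.Normc.normcM mulrC.
  by rewrite ler_wpM2r ?normc_ge0.
Qed.

(** The Lipschitz bounds of the waves are integrated over [p]. They contain one factor |a|, hence
    the decay of order 1 asked of [W]. *)
Lemma superposition_continuous W k : rapid W ->
  continuous (fun x => complex.Re (superposition W k x)) /\
  continuous (fun x => complex.Im (superposition W k x)).
Proof.
move=> rW; have [M M0 HM] := ridge_wave_lipschitz HX W k.
have [K HK] := rW.2 1%N.
have mY := @measurable_Y R n.
have iB := integrable_Y_boundM (M * n%:R * `|K|).
pose I := \int[nu]_(p in YS) (M * n%:R * `|K| * Y_bound p).
have I0 : 0 <= I.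
  by apply: Rintegral_ge0 => p _; rewrite !mulr_ge0// Y_bound_ge0.
apply: (@clipschitz_continuous _ _ _ (2 * I)) => [|x y].
  by rewrite mulr_ge0.
rewrite /superposition.
have -> : cintegral nu YS (fun p => ridge_wave X p W k x) -
    cintegral nu YS (fun p => ridge_wave X p W k y) =
    cintegral nu YS (fun p => ridge_wave X p W k x + (-1) * ridge_wave X p W k y).
  rewrite cintegralD ?cintegralZl ?mulN1r//;
    by do ?apply: cintegrableZl => //; exact: cintegrable_ridge_wave.
rewrite -mulrA -RintegralZr//.
apply: (normc_cintegral_le mY).
- apply: cintegrableD => //; last apply: cintegrableZl => //;
    exact: cintegrable_ridge_wave.
- exact: (integrableZr mY _ iB).
move=> p Yp; rewrite mulN1r; apply: le_trans (HM _ _ _) _.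
rewrite ler_wpM2r//.
rewrite [leRHS](_ : _ = M * (`|K| * Y_bound p * n%:R)); last by ring.
rewrite ler_wpM2l//; apply: ler_pM.
- by rewrite mulr_ge0 ?normc_ge0.
- by rewrite sumr_ge0.
- have := HK p Yp; rewrite expr1 => /le_trans; apply.
  by rewrite ler_wpM2r ?Y_bound_ge0 ?ler_norm.
- apply: (@le_trans _ _ (\sum_(i < n) 1)); last by rewrite sumr_const card_ord.
  by apply: ler_sum => i _; case: Yp => <- _; rewrite coord_le_enorm.
Qed.

(* The two real components of W * X are combinations of the real and the
   imaginary part of X, hence the common form of the integrand. *)
Let superposition_is_derive (pi : C -> R) (al be : C -> R) W k x v : rapid W ->
  (forall c z, pi (c * z) = al c * complex.Re z + be c * complex.Im z) ->
  (forall (p : EY) z, pi (dirweight v W p * z) =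
    p.2 * dotv v p.1.1 * (al (W p) * complex.Re z + be (W p) * complex.Im z)) ->
  (forall F, cintegrable nu YS F -> nu.-integrable YS (fun p => (pi (F p))%:E)) ->
  (forall z, `|pi z| <= normc z) ->
  is_derive x v (fun y => \int[nu]_(p in YS) pi (ridge_wave X p W k y))
    (\int[nu]_(p in YS) pi (ridge_wave X p (dirweight v W) k.+1 x)).
Proof.
move=> rW piE pidE ipi npi; apply/is_derive_line.
have mY := @measurable_Y R n.
have rvW := rapid_dirweight v rW.
have [_ _ XM] := HX; have [M HM] := XM k.+1.
have M0 : 0 <= M by apply: le_trans (HM 0); exact: normc_ge0.
pose f (h : R) (p : YT) := pi (ridge_wave X p W k (h *: v + x)).
have df (h : R) p : is_derive h 1 (f ^~ p)
    (pi (ridge_wave X p (dirweight v W) k.+1 (h *: v + x))).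
  rewrite /f /ridge_wave pidE; under eq_fun do rewrite piE.
  exact: is_derive_ridge.
(* Any interval around 0 would serve: the majorant [G] does not depend on [h]. *)
have z0 : `]-1, 1[%classic (0 : R) by rewrite /= in_itv/= ltrN10 ltr01.
have intf (h : R) : `]-1, 1[%classic h -> nu.-integrable YS (EFin \o f h).
  by move=> _; apply: ipi; exact: cintegrable_ridge_wave.
have derf (h : R) p : `]-1, 1[%classic h -> YS p -> derivable (f ^~ p) h 1.
  by move=> _ _; exact: (@ex_derive _ _ _ _ _ _ _ (df h p)).
pose G (p : YT) := M * normc (dirweight v W p).
have G0 p : 0 <= G p by rewrite mulr_ge0// normc_ge0.
have iG : nu.-integrable YS (EFin \o G).
  have iN := integrable_normc mY (rapid_integrable rvW).
  exact: (integrableZl mY M iN).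
have derE (h : R) p : partial1of2 f h p =
    pi (ridge_wave X p (dirweight v W) k.+1 (h *: v + x)).
  by rewrite partial1of2E; exact: (@derive_val _ _ _ _ _ _ _ (df h p)).
have Gub (h : R) p : `]-1, 1[%classic h -> YS p -> `|partial1of2 f h p| <= G p.
  move=> _ _; rewrite derE; apply: le_trans (npi _) _.
  by rewrite ComplexField.Normc.normcM mulrC ler_wpM2r ?normc_ge0.
apply: DeriveDef.
  exact: (derivable_under_integral mY z0 intf derf G0 iG Gub).
rewrite -derive1E (differentiation_under_integral mY z0 intf derf G0 iG Gub).
by apply: eq_Rintegral => p _; rewrite derE scale0r add0r.
Qed.

Lemma bounded_smooth_superposition W k : rapid W ->
  bounded_smooth (superposition W k) /\
  forall al, multi_deriv al (superposition W k) =
    superposition (multiweight al W) (mi_order al + k).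
Proof.
have dRe W' k' x v : rapid W' ->
    is_derive x v (fun y => complex.Re (superposition W' k' y))
      (complex.Re (superposition (dirweight v W') k'.+1 x)).
  move=> rW'; exact: (@superposition_is_derive (@complex.Re R) (@complex.Re R)
    (fun c => - complex.Im c) W' k' x v rW' (@Re_mulE R)
    (@Re_dirweight R n v W') (fun F => @proj1 _ _) (@normr_Re_le R)).
have dIm W' k' x v : rapid W' ->
    is_derive x v (fun y => complex.Im (superposition W' k' y))
      (complex.Im (superposition (dirweight v W') k'.+1 x)).
  move=> rW'; exact: (@superposition_is_derive (@complex.Im R) (@complex.Im R) (@complex.Re R)
    W' k' x v rW' (@Im_mulE R) (@Im_dirweight R n v W') (fun F => @proj2 _ _)
    (@normr_Im_le R)).
move=> rW; split => [|al].
- apply: (bounded_smooth_family rapid_dirweight dRe dIm) => //.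
  + exact: superposition_continuous.
  + exact: superposition_bounded.
- exact: (multi_deriv_family rapid_dirweight dRe dIm).
Qed.

End superposition.

(** * The Stockwell transform *)

Section multiweight_theory.
Variables (R : realType) (n : nat).
Local Notation C := R[i].
Local Notation E := 'rV[R]_n.
Local Notation EY := (E * R * R)%type.
Local Notation multiindex := {ffun 'I_n -> nat}.

(** Factors independent of x pass through x-derivatives; this lets the test function leave the
    weight of a wavelet. *)
Lemma multiweightM al (h W : EY -> C) p :
  multiweight al (fun q => h q * W q) p = h p * multiweight al W p.
Proof.
rewrite /multiweight; elim: (enum _) p => //= i s IH.
elim: (al i) => [|c IHc] p; first exact: IH.
by rewrite /= /dirweight IHc mulrCA.
Qed.

(** [D] does not depend on [W]; continuity of the transform rests on this uniformity. *)
Lemma normc_multiweight al : exists2 D, 0 <= D & forall (W : EY -> C) p, Y p ->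
  normc (multiweight al W p) <= D * (normc (W p) * `|p.2| ^+ mi_order al).
Proof.
rewrite /multiweight /mi_order -(big_enum _ _ _ al) /=.
elim: (enum _) => [|i s [D D0 IH]].
  by exists 1 => // W p _; rewrite big_nil expr0 mulr1 mul1r.
rewrite big_cons /=; elim: (al i) => [|c [D' D'0 IHc]]; first by exists D.
exists (n%:R * `|delta_mx ord0 i : E| * D'); first by rewrite !mulr_ge0.
move=> W p Yp; apply: le_trans (normc_dirweight _ _ Yp) _.
rewrite -[leRHS]mulrA ler_wpM2l ?mulr_ge0//.
apply: le_trans (ler_wpM2r (normr_ge0 _) (IHc W p Yp)) _.
by rewrite addSn exprSr !mulrA.
Qed.

Lemma rapid_multiweight al (W : EY -> C) : rapid W -> rapid (multiweight al W).
Proof. by move=> rW; apply: good_multiweight rW; exact: rapid_dirweight. Qed.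

End multiweight_theory.

(** * Exchange of a superposition with the pairing against an L^1 function *)

Section pairing.
Variables (R : realType) (n : nat).
Local Notation C := R[i].
Local Notation E := 'rV[R]_n.
Local Notation EY := (E * R * R)%type.
Local Notation YT := ((E * measurableTypeR R) * measurableTypeR R)%type.
Local Notation nu := (@Y_measure R n).
Local Notation YS := (@Y R n : set YT).
Local Notation lebn := (lebesgue_rV R n).

Let surfs : {sigma_finite_measure set E -> \bar R} := @surface_measure R n.
Let surfleb : {sigma_finite_measure set (E * measurableTypeR R)%type -> \bar R} :=
  sigma_finite_pack (sigma_finite_product surfs (@lebesgue_measure R)).
Let nus : {sigma_finite_measure set YT -> \bar R} :=
  sigma_finite_pack (sigma_finite_product surfleb (@lebesgue_measure R)).
Let lebs : {sigma_finite_measure set E -> \bar R} :=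
  sigma_finite_pack (@lebesgue_rV_sigma_finite R n).

Variable X : nat -> R -> C.
Hypothesis HX : bounded_profile X.
Variable g : E -> C.
Hypothesis ig : cintegrable lebn setT g.

Definition pairing (V : EY -> C) k (p : EY) : C :=
  cintegral lebn setT (fun x => g x * ridge_wave X p V k x).

Lemma cintegrable_mul_ridge_wave V k p :
  cintegrable lebn setT (fun x => g x * ridge_wave X p V k x).
Proof.
have [_ _ XM] := HX; have [M HM] := XM k.
have iN := integrable_normc measurableT ig.
apply: (@le_cintegrable _ _ _ _ _ measurableT _
  (fun x => normc (V p) * M * normc (g x))).
- apply: cmeasurableM; first exact: cintegrable_measurable ig.
  apply: cmeasurableM; first exact: cmeasurable_cst.
  by apply: (@cmeasurable_profile_ridge _ _ _ HX _ _ idfun (fun=> p));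
    [exact: measurable_id|exact: measurable_cst].
- exact: (integrableZl measurableT _ iN).
- move=> x _; rewrite !ComplexField.Normc.normcM mulrC.
  by rewrite ler_wpM2r ?normc_ge0// ler_wpM2l ?normc_ge0.
Qed.

Lemma normc_pairing_le k : exists2 K, 0 <= K &
  forall V p, normc (pairing V k p) <= K * normc (V p).
Proof.
have [_ _ XM] := HX; have [M HM] := XM k.
have M0 : 0 <= M by apply: le_trans (HM 0); exact: normc_ge0.
have iN := integrable_normc measurableT ig.
exists (2 * (\int[lebn]_x normc (g x) * M)).
  by rewrite !mulr_ge0// Rintegral_ge0// => x _; exact: normc_ge0.
move=> V p; rewrite -!mulrA -RintegralZr//.
apply: (normc_cintegral_le measurableT (cintegrable_mul_ridge_wave V k p)).
  exact: (integrableZr measurableT _ iN).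
move=> x _; rewrite !ComplexField.Normc.normcM ler_wpM2l ?normc_ge0//.
by rewrite mulrC ler_wpM2r ?normc_ge0.
Qed.

(** As the profile is bounded by [M], the integrand is dominated by M |V(p)| |g(x)|, a product of
    integrable functions of p and of x. *)
Lemma pairing_fubini V k : rapid V ->
  cintegrable nu YS (pairing V k) /\
  cintegral lebn setT (fun x => g x * superposition X V k x) =
  cintegral nu YS (pairing V k).
Proof.
move=> rV; have [_ _ XM] := HX; have [M HM] := XM k.
have mY := @measurable_Y R n.
have mg := cintegrable_measurable ig.
have iN := integrable_normc measurableT ig.
have iV := (cintegrable_mkcond _ mY _).1 (rapid_integrable rV).
have iNV := integrableZl measurableT M (integrable_normc measurableT iV).
pose H (z : YT * E) : C :=
  g z.2 * (V z.1 * (\1_YS z.1)%:C * X k (ridge z.2 z.1)).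
have mH : cmeasurable setT H.
  apply: cmeasurableM; first exact: cmeasurable_comp mg measurable_snd.
  apply: cmeasurableM.
    exact: (cmeasurable_comp (cintegrable_measurable iV) measurable_fst).
  by apply: (@cmeasurable_profile_ridge _ _ _ HX _ _ snd fst);
    [exact: measurable_snd|exact: measurable_fst].
have bH p x : normc (H (p, x)) <= M * normc (V p * (\1_YS p)%:C) * normc (g x).
  rewrite /H/= ComplexField.Normc.normcM mulrC ler_wpM2r ?normc_ge0//.
  rewrite ComplexField.Normc.normcM mulrC.
  by rewrite ler_wpM2r ?normc_ge0.
have [iH s1 s2] := @cintegrable_prod _ _ _ _ _ nus lebs _ _ iNV iN H mH bH.
have swap := @cfubini _ _ _ _ _ nus lebs _ _ iNV iN H mH bH.
have [K1 _] := @cintegrable_fubini1 _ _ _ _ _ nus lebs H iH s1.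
have HE p : cintegral lebs setT (fun x => H (p, x)) =
    pairing V k p * (\1_YS p)%:C.
  rewrite mulrC -(cintegralZl measurableT) ?cintegrable_mul_ridge_wave//.
    by apply: eq_cintegral => x _; rewrite /H /ridge_wave/=; ring.
  exact: cintegrable_mul_ridge_wave.
split.
  apply: (cintegrable_mkcond nu mY _).2.
  by apply: (eq_cintegrable measurableT _ K1) => p _; exact: HE.
rewrite [RHS](cintegral_mkcond nu).
rewrite -(@eq_cintegral _ _ _ nu setT _ _ (fun p _ => HE p)).
rewrite [RHS]swap; apply: eq_cintegral => x _.
rewrite /superposition -(cintegralZl mY); last exact: cintegrable_ridge_wave.
rewrite (cintegral_mkcond nu); apply: eq_cintegral => p _.
by rewrite /H /ridge_wave/=; ring.
Qed.

End pairing.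

(** * The wavelet as a ridge wave *)

Section schwartz_profile.
Variable R : realType.
Local Notation C := R[i].
Local Notation e1 := (delta_mx ord0 ord0 : 'rV[R]_1).

(** The conjugate is built in because the transform pairs [f] with conjugated wavelets. *)
Definition profile (L : 'rV[R]_1 -> C) (k : nat) (t : R) : C :=
  conjc (iter k (cderive e1) L (const_mx t)).

Let is_derive_const_mx (f : 'rV[R]_1 -> R) (t : R) : derivable f (const_mx t) e1 ->
  is_derive t 1 (fun s : R => f (const_mx s)) ('D_e1 f (const_mx t)).
Proof.
move=> /DeriveDef/(_ erefl)/is_derive_line h; apply/is_derive_line.
have E : (fun h : R => f (const_mx (h *: 1 + t))) =
    (fun h : R => f (h *: e1 + const_mx t)).
  apply/funext => s; congr f; apply/rowP => i; rewrite !mxE !ord1 !eqxx/=.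
  by [].
by rewrite E.
Qed.

Lemma bounded_profile_schwartz (L : 'rV[R]_1 -> C) :
  schwartz L -> bounded_profile (profile L).
Proof.
move=> [[sRe sIm] semi].
have ReE k : (fun x => complex.Re (iter k (cderive e1) L x)) =
    foldr (fun v h => 'D_v h : 'rV[R]_1 -> R) (fun x => complex.Re (L x)) (nseq k e1).
  by elim: k => //= k <-.
have ImE k : (fun x => complex.Im (iter k (cderive e1) L x)) =
    foldr (fun v h => 'D_v h : 'rV[R]_1 -> R) (fun x => complex.Im (L x)) (nseq k e1).
  by elim: k => //= k <-.
split.
- move=> k t; under eq_fun do rewrite Re_conj; rewrite Re_conj.
  apply: is_derive_const_mx; rewrite ReE.
  by have [_] := sRe (nseq k e1) (const_mx t) I; exact.
- move=> k t; under eq_fun do rewrite Im_conj; rewrite Im_conj.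
  apply: is_deriveN.
  apply: is_derive_const_mx; rewrite ImE.
  by have [_] := sIm (nseq k e1) (const_mx t) I; exact.
move=> k; pose al : {ffun 'I_1 -> nat} := [ffun=> k].
(* With the trivial monomial, this seminorm is the supremum of the k-th derivative. *)
have := semi ([ffun=> 0%N], al); rewrite /schwartz_seminorm.
set A := [set _ | _ in _] => supA.
have ubA t : ((normc (profile L k t))%:E <= ereal_sup A)%E.
  apply: ereal_sup_ubound; exists (const_mx t) => //=.
  rewrite /monomial big1 => [|i _]; last by rewrite ffunE expr0.
  rewrite normr1 mul1r /profile normc_conj /multi_deriv.
  rewrite enum_ordSl/= ffunE; congr (_%:E).
  by rewrite (_ : enum 'I_0 = [::])//; apply: size0nil; rewrite size_enum_ord.
exists (fine (ereal_sup A)) => t.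
rewrite -lee_fin fineK// fin_numElt supA andbT.
by apply: lt_le_trans (ubA t); rewrite ltNyr.
Qed.

End schwartz_profile.

Section wavelet_as_ridge.
Variables (R : realType) (n : nat) (psi : R -> R[i]).
Local Notation C := R[i].
Local Notation E := 'rV[R]_n.
Local Notation EY := (E * R * R)%type.
Local Notation YT := ((E * measurableTypeR R) * measurableTypeR R)%type.
Local Notation YS := (@Y R n : set YT).

Definition wavelet_profile : nat -> R -> C :=
  profile (fun x : 'rV[R]_1 => cis (x ord0 ord0) * psi (x ord0 ord0)).

Definition wavelet_coef (p : EY) : C :=
  (`|p.2| / (2 * pi) `^ (n%:R / 2))%:C * conjc (cis (p.2 * p.1.2)).

(* With s = a(x.u - b) one has e^{ia x.u} = e^{is} e^{iab}, so the modulation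
   is absorbed into the profile e^{is} psi(s), which is Schwartz by the
   definition of S_1. *)
Lemma conj_wavelet p x :
  conjc (wavelet psi p x) = ridge_wave wavelet_profile p wavelet_coef 0 x.
Proof.
case: p => [[u b] a]; rewrite /wavelet /ridge_wave /wavelet_coef /wavelet_profile.
rewrite (_ : a * dotv x u = a * (dotv x u - b) + a * b); last by ring.
rewrite cisD /profile [iter 0 _ _]/= /ridge !mxE [(_, _, a).2]/=.
rewrite [(_, _, a).1.1]/= [(_, _, a).1.2]/= !conj_mul conj_real.
by move: (psi _) (conjc (cis _)) (conjc (cis _)) => s c1 c2; ring.
Qed.

Lemma bounded_profile_wavelet : schwartz1 psi -> bounded_profile wavelet_profile.
Proof. by move=> [_ [h _]]; exact: bounded_profile_schwartz. Qed.

Definition wavelet_const : R := ((2 * pi) `^ (n%:R / 2))^-1.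

Lemma wavelet_const_ge0 : 0 <= wavelet_const.
Proof. by rewrite invr_ge0 powR_ge0. Qed.

Lemma normc_wavelet_coef p : normc (wavelet_coef p) = `|p.2| * wavelet_const.
Proof.
rewrite ComplexField.Normc.normcM normc_real normc_conj normc_cis mulr1.
by rewrite ger0_norm// divr_ge0// powR_ge0.
Qed.

(** The seminorm with r = 2 and no derivatives is at most [M]: the exponent r/2 is then 1 and gives
    the factor 1 + b^2 of the majorant. *)
Definition decay s M (Phi : EY -> C) : Prop := forall p, Y p ->
  (1 + `|p.1.2| ^+ 2) * (`|p.2| ^+ s + `|p.2| ^- s) * normc (Phi p) <= M.

(** This class passes to linear combinations by the triangle inequality, with no derivatives to
    expand. *)
Definition decreasing_Y (Phi : EY -> C) : Prop :=
  cmeasurable YS Phi /\ forall s, exists M, decay s M Phi.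

Definition wavelet_weight (Phi : EY -> C) (p : EY) : C :=
  Phi p * (`|p.2| ^+ (n - 2))%:C * wavelet_coef p.

(** The two extra powers of |a| pay for the factor 1/(1 + a^2) of the majorant. *)
Lemma decay_le q M Phi p : decay q.+2 M Phi -> Y p ->
  normc (Phi p) * `|p.2| ^+ q <= M * 2 * Y_bound p.
Proof.
move=> dM Yp; have := dM p Yp; case: p Yp => [[u b] a] /= [Su a0] h.
have A0 : 0 < `|a| by rewrite normr_gt0.
rewrite /Y_bound/= indicE mem_set// mul1r mulrA.
have B0 : 0 < oneDsqr b by apply: lt_le_trans (oneDsqr_ge1 _).
have D0 : 0 < oneDsqr a by apply: lt_le_trans (oneDsqr_ge1 _).
rewrite ler_pdivlMr// ler_pdivlMr//.
have bb : `|b| ^+ 2 = b ^+ 2 by rewrite real_normK ?num_real.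
have aa : a ^+ 2 = `|a| ^+ 2 by rewrite real_normK ?num_real.
rewrite bb -/(oneDsqr b) in h.
(* For |a| at most 1 both terms on the left are at most 1, and so at most the negative power;
   otherwise both are at most the positive power. *)
have key : `|a| ^+ q * oneDsqr a <= 2 * (`|a| ^+ q.+2 + `|a| ^- q.+2).
  rewrite /oneDsqr aa mulrDr mulr1 -exprD addn2.
  have V0 : 0 <= `|a| ^- q.+2 by rewrite invr_ge0 exprn_ge0.
  have [a1|a1] := leP `|a| 1.
    have e1 : `|a| ^+ q <= 1 by rewrite exprn_ile1.
    have e2 : `|a| ^+ q.+2 <= 1 by rewrite exprn_ile1.
    have e3 : 1 <= `|a| ^- q.+2.
      by rewrite invf_ge1 ?exprn_gt0.
    have e4 : 0 <= `|a| ^+ q.+2 by rewrite exprn_ge0.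
    lra.
  have e1 : `|a| ^+ q <= `|a| ^+ q.+2.
    by apply: ler_weXn2l; [exact: ltW|rewrite -addn2 leq_addr].
  lra.
have := ler_wpM2l (mulr_ge0 (ltW B0) (normc_ge0 (Phi (u, b, a)))) key.
nra.
Qed.

Lemma normc_wavelet_weight Phi p m : normc (wavelet_weight Phi p) * `|p.2| ^+ m =
  wavelet_const * (normc (Phi p) * `|p.2| ^+ (m + (n - 2)).+1).
Proof.
rewrite /wavelet_weight ComplexField.Normc.normcM normc_wavelet_coef.
rewrite ComplexField.Normc.normcM normc_real.
rewrite (ger0_norm (exprn_ge0 _ (normr_ge0 _))) exprS exprD; ring.
Qed.

(** Of the powers beyond [m], n - 2 come from the density of the measure, one from the factor |a| of
    the wavelet and two from integrability in a. *)
Lemma decay_wavelet_weight m M Phi p : decay (m + (n - 2)).+3 M Phi -> Y p ->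
  normc (wavelet_weight Phi p) * `|p.2| ^+ m <=
  wavelet_const * 2 * M * Y_bound p.
Proof.
move=> dM Yp; rewrite normc_wavelet_weight -!mulrA ler_wpM2l ?wavelet_const_ge0//.
by apply: le_trans (decay_le dM Yp) _; rewrite -mulrA mulrCA.
Qed.

Lemma rapid_wavelet_weight Phi : decreasing_Y Phi -> rapid (wavelet_weight Phi).
Proof.
move=> [mPhi dPhi]; split; last first.
  move=> m; have [M dM] := dPhi (m + (n - 2)).+3.
  by exists (wavelet_const * 2 * M) => p Yp; exact: decay_wavelet_weight.
have ma : measurable_fun setT (fun p : YT => `|p.2| : measurableTypeR R).
  exact: (measurableT_comp _ measurable_snd).
apply: cmeasurableM; first apply: cmeasurableM => //.
  by apply: cmeasurable_real; apply: measurable_funTS; exact: measurable_funX.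
apply: (cmeasurableS measurableT (@subsetT _ _)).
apply: cmeasurableM.
  by apply: cmeasurable_real; exact: measurable_funM.
apply/cmeasurable_conj/cmeasurable_cis/measurable_funM.
  exact: measurable_snd.
exact: (measurableT_comp measurable_snd measurable_fst).
Qed.

Lemma decreasing_Y_linear (c : C) Phi Chi : decreasing_Y Phi -> decreasing_Y Chi ->
  decreasing_Y (fun p => c * Phi p + Chi p).
Proof.
move=> [m1 d1] [m2 d2]; split.
  by apply: cmeasurableD => //; apply: cmeasurableM => //; exact: cmeasurable_cst.
move=> s; have [M1 D1] := d1 s; have [M2 D2] := d2 s.
exists (normc c * M1 + M2) => p Yp.
have w0 : 0 <= (1 + `|p.1.2| ^+ 2) * (`|p.2| ^+ s + `|p.2| ^- s).
  by rewrite mulr_ge0 ?addr_ge0 ?invr_ge0 ?exprn_ge0.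
apply: le_trans (ler_wpM2l w0 (le_normcD _ _)) _.
rewrite mulrDr ComplexField.Normc.normcM lerD ?D2// mulrCA.
by rewrite ler_wpM2l ?normc_ge0 ?D1.
Qed.

Lemma sphere_neq0 (u : E) : @sphere R n u -> u != 0.
Proof.
move=> Su; apply/eqP => u0; move: Su; rewrite u0 /sphere/= /enorm /dotv big1.
  by rewrite sqrtr0 => /eqP; rewrite eq_sym oner_eq0.
by move=> i _; rewrite mxE mul0r.
Qed.

Lemma schwartz_Y_decreasing Phi : schwartz_Y Phi -> decreasing_Y Phi.
Proof.
move=> [[sRe sIm] semi]; split.
  have eqY p : p \in YS -> radial_ext Phi p = Phi p.
    case: p => [[u b] a] /set_mem[/= Su _]; rewrite /radial_ext/= /direction.
    by rewrite Su invr1 scale1r.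
  split; [apply: (@eq_measurable_fun _ _ _ _ _ (fun p => complex.Re (radial_ext Phi p)))
         |apply: (@eq_measurable_fun _ _ _ _ _ (fun p => complex.Im (radial_ext Phi p)))].
  - by move=> p Yp; rewrite eqY.
  - apply: continuous_measurable_fun_rV => p [Su a0].
    (* The empty list of directions gives continuity of the extension itself. *)
    by have [] := sRe [::] p (conj (sphere_neq0 Su) a0).
  - by move=> p Yp; rewrite eqY.
  - apply: continuous_measurable_fun_rV => p [Su a0].
    by have [] := sIm [::] p (conj (sphere_neq0 Su) a0).
move=> s; have := semi (s, 2, 0, 0, 0)%N; rewrite /Y_seminorm.
set A := [set _ | _ in _] => supA.
exists (fine (ereal_sup A)) => p Yp.
set w := (X in X <= _).
have ubA : (w%:E <= ereal_sup A)%E.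
  apply: ereal_sup_ubound; exists p => //=.
  by rewrite divff ?pnatr_eq0// powRr1// addr_ge0.
rewrite -lee_fin fineK// fin_numElt supA andbT.
by apply: lt_le_trans ubA; rewrite ltNyr.
Qed.

Lemma Y_seminorm_decay s (M : R) Phi :
  (Y_seminorm (s, 2, 0, 0, 0)%N Phi < M%:E)%E -> decay s M Phi.
Proof.
rewrite /Y_seminorm; set A := [set _ | _ in _] => supA p Yp.
rewrite -lee_fin; apply: le_trans (ltW supA).
apply: ereal_sup_ubound; exists p => //=.
by rewrite divff ?pnatr_eq0// powRr1// addr_ge0.
Qed.

End wavelet_as_ridge.

(** * The distributional transform as an integral *)

Section stockwell_transform.
Variables (R : realType) (n : nat) (psi : R -> R[i]).
Local Notation C := R[i].
Local Notation E := 'rV[R]_n.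
Local Notation EY := (E * R * R)%type.
Local Notation YT := ((E * measurableTypeR R) * measurableTypeR R)%type.
Local Notation YS := (@Y R n : set YT).
Local Notation nu := (@Y_measure R n).
Local Notation lebn := (lebesgue_rV R n).
Local Notation multiindex := {ffun 'I_n -> nat}.
Hypothesis hpsi : schwartz1 psi.
Let X := wavelet_profile psi.
Let HX : bounded_profile X := bounded_profile_wavelet hpsi.

(** The two conjugations cancel on [Phi] and leave the conjugated wavelet, which is a ridge wave;
    [integral_YE] turns the iterated integral into a superposition. *)
Lemma conj_synthesis (Phi : EY -> C) : decreasing_Y Phi ->
  (fun x => conjc (synthesis psi (fun p => conjc (Phi p)) x)) =
  superposition X (wavelet_weight Phi) 0.
Proof.
move=> dPhi; have rW := rapid_wavelet_weight dPhi; apply/funext => x.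
have iW := cintegrable_ridge_wave HX 0 x rW.
have FE (p : EY) : conjc (Phi p) * wavelet psi p x * (`|p.2| ^+ (n - 2))%:C =
    conjc (ridge_wave X p (wavelet_weight Phi) 0 x).
  rewrite /ridge_wave /wavelet_weight -[wavelet psi p x]conjcK conj_wavelet.
  by rewrite /ridge_wave !conj_mul !conj_real; ring.
have mF : cmeasurable YS (fun p : YT =>
    conjc (Phi p) * wavelet psi p x * (`|p.2| ^+ (n - 2))%:C).
  rewrite (funext FE); apply: cmeasurable_conj; exact: cintegrable_measurable iW.
have [_ _ XM] := HX; have [K HK] := XM 0%N.
have [M HM] := rW.2 0%N.
have bF (p : EY) : Y p ->
    normc (conjc (Phi p) * wavelet psi p x * (`|p.2| ^+ (n - 2))%:C) <=
    K * M * Y_bound p.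
  move=> Yp; rewrite FE normc_conj ComplexField.Normc.normcM.
  have K0 : 0 <= K by apply: le_trans (HK 0); exact: normc_ge0.
  rewrite mulrC -mulrA; apply: ler_pM; rewrite ?normc_ge0//.
  by have := HM p Yp; rewrite expr0 mulr1.
rewrite /synthesis (integral_YE mF bF).2.
rewrite (@eq_cintegral _ _ _ nu YS _ _ (fun p _ => FE p)).
by rewrite (cintegral_conj (@measurable_Y R n) iW) conjcK.
Qed.

Variables (f : (E -> C) -> C) (N : nat) (al : 'I_N -> multiindex) (g : 'I_N -> E -> C).
Hypothesis ig : forall j, cintegrable lebn setT (g j).
Hypothesis fE : forall phi, bounded_smooth phi ->
  f phi = \sum_(j < N) (-1) ^+ (\sum_i al j i)%N *
    cintegral lebn setT (fun x => g j x * multi_deriv (al j) phi x).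

Let sgn (j : 'I_N) : C := (-1) ^+ (\sum_i al j i)%N.
Let ord (j : 'I_N) : nat := (mi_order (al j) + 0)%N.
Let weight Phi (j : 'I_N) := multiweight (al j) (@wavelet_weight R n Phi).

Definition stockwell_density (Phi : EY -> C) (p : EY) : C :=
  stockwell_fun psi f p * Phi p * (`|p.2| ^+ (n - 2))%:C.

(** The weights are those that arise when the synthesis integral is differentiated in x, so the two
    sides of the theorem can be compared term by term. *)
Lemma stockwell_densityE (Phi : EY -> C) p : stockwell_density Phi p =
  \sum_(j < N) sgn j * pairing X (g j) (weight Phi j) (ord j) p.
Proof.
rewrite /stockwell_density /stockwell_fun.
rewrite (_ : (fun x => _) = ridge_wave X p (@wavelet_coef R n) 0); last first.
  by apply/funext => x; exact: conj_wavelet.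
rewrite fE; last exact: bounded_smooth_ridge_wave.
rewrite -mulrA mulr_suml; apply: eq_bigr => j _; rewrite -mulrA; congr (_ * _).
rewrite (multi_deriv_ridge_wave HX) /pairing -/(ord j).
rewrite mulrC -(cintegralZl measurableT); last exact: cintegrable_mul_ridge_wave.
apply: eq_cintegral => x _; rewrite /ridge_wave /weight.
by rewrite (multiweightM (al j) (fun p => Phi p * (`|p.2| ^+ (n - 2))%:C)); ring.
Qed.

Lemma cintegrable_stockwell_density (Phi : EY -> C) : decreasing_Y Phi ->
  cintegrable nu YS (stockwell_density Phi).
Proof.
move=> dPhi; rewrite (funext (stockwell_densityE Phi)).
apply: (cintegrable_sum (@measurable_Y R n)) => j.
apply: (cintegrableZl (@measurable_Y R n)).
apply: (pairing_fubini HX (ig j) _ _).1.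
exact/rapid_multiweight/rapid_wavelet_weight.
Qed.

Lemma stockwell_dist_density (Phi : EY -> C) : decreasing_Y Phi ->
  stockwell_dist psi f Phi = cintegral nu YS (stockwell_density Phi).
Proof.
move=> dPhi; have rW := rapid_wavelet_weight dPhi.
have rj j := rapid_multiweight (al j) rW.
have [bs md] := bounded_smooth_superposition HX 0 rW.
rewrite /stockwell_dist conj_synthesis// fE//.
rewrite (funext (stockwell_densityE Phi)).
rewrite (cintegral_sum (@measurable_Y R n)); last first.
  move=> j; apply: (cintegrableZl (@measurable_Y R n)).
  exact: (pairing_fubini HX (ig j) _ (rj j)).1.
apply: eq_bigr => j _; rewrite (cintegralZl (@measurable_Y R n)); last first.
  exact: (pairing_fubini HX (ig j) _ (rj j)).1.
by rewrite md (pairing_fubini HX (ig j) _ (rj j)).2.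
Qed.

(** The case of [decay_wavelet_weight] in which [m] counts the powers of |a| produced by the j-th
    derivative. *)
Let decay_index (j : 'I_N) : nat := (mi_order (al j) + (n - 2)).+3.

(** [K] is independent of [Phi] and the bound is linear in [M], so one estimate yields both
    domination and continuity. *)
Lemma normc_stockwell_density_le : exists2 K, 0 <= K & forall (Phi : EY -> C) M,
  (forall j, decay (decay_index j) M Phi) ->
  forall p, Y p -> normc (stockwell_density Phi p) <= K * M * Y_bound p.
Proof.
have H j : exists K, 0 <= K /\ forall (Phi : EY -> C) M, decay (decay_index j) M Phi ->
    forall p, Y p -> normc (sgn j * pairing X (g j) (weight Phi j) (ord j) p) <=
      K * M * Y_bound p.
  have [K K0 HK] := normc_pairing_le HX (ig j) (ord j).
  have [D D0 HD] := normc_multiweight R (al j).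
  exists (normc (sgn j) * K * D * (wavelet_const R n * 2)); split.
    by rewrite !mulr_ge0 ?normc_ge0 ?wavelet_const_ge0.
  move=> Phi M dM p Yp; rewrite ComplexField.Normc.normcM.
  rewrite -!mulrA ler_wpM2l ?normc_ge0//.
  apply: le_trans (HK _ _) _; rewrite ler_wpM2l//.
  apply: le_trans (HD _ _ Yp) _; rewrite ler_wpM2l//.
  by apply: le_trans (decay_wavelet_weight dM Yp) _; rewrite !mulrA.
have [K HK] := choice H.
exists (\sum_j K j); first by apply: sumr_ge0 => j _; exact: (HK j).1.
move=> Phi M dM p Yp; rewrite stockwell_densityE !mulr_suml.
have : forall (I : eqType) (s : seq I) (F : I -> C) (b : I -> R),
    (forall i, normc (F i) <= b i) -> normc (\sum_(i <- s) F i) <= \sum_(i <- s) b i.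
  move=> I s F b Fb; elim: s => [|i s IH].
    by rewrite !big_nil/= expr0n/= addr0 sqrtr0.
  by rewrite !big_cons; apply: le_trans (le_normcD _ _) _; exact: lerD.
by apply=> j; exact: (HK j).2.
Qed.

Lemma stockwell_density_bounded (Phi : EY -> C) : decreasing_Y Phi ->
  exists M, forall p, Y p -> normc (stockwell_density Phi p) <= M * Y_bound p.
Proof.
move=> [_ dPhi]; have [K K0 HK] := normc_stockwell_density_le.
have [M HM] := choice (fun j => dPhi (decay_index j)).
(* The sum is a common bound for the finitely many decay conditions. *)
exists (K * \sum_j `|M j|); apply: HK => j p Yp.
apply: le_trans (HM j p Yp) _; apply: le_trans (ler_norm _) _.
by rewrite (bigD1 j)//= lerDl sumr_ge0.
Qed.

Lemma stockwell_dist_integral (Phi : EY -> C) : decreasing_Y Phi ->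
  stockwell_dist psi f Phi = integral_Y (fun p => stockwell_fun psi f p * Phi p).
Proof.
move=> dPhi; rewrite stockwell_dist_density//.
have [M HM] := stockwell_density_bounded dPhi.
have iF := cintegrable_stockwell_density dPhi.
by rewrite (integral_YE (cintegrable_measurable iF) HM).2.
Qed.

Lemma stockwell_densityD c (Phi Chi : EY -> C) p :
  stockwell_density (fun q => c * Phi q + Chi q) p =
  c * stockwell_density Phi p + stockwell_density Chi p.
Proof. by rewrite /stockwell_density; ring. Qed.

(** The distribution [f] is linear by definition on Schwartz functions, whereas the synthesis
    integral is known here as a bounded smooth function. Linearity is therefore taken from the
    integral of the density. *)
Lemma stockwell_dist_linear c (Phi Chi : EY -> C) :
  decreasing_Y Phi -> decreasing_Y Chi ->
  stockwell_dist psi f (fun p => c * Phi p + Chi p) =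
  c * stockwell_dist psi f Phi + stockwell_dist psi f Chi.
Proof.
move=> dPhi dChi; rewrite !stockwell_dist_density//; last exact: decreasing_Y_linear.
have i1 := cintegrable_stockwell_density dPhi.
have i2 := cintegrable_stockwell_density dChi.
have mY := @measurable_Y R n.
rewrite (funext (stockwell_densityD c Phi Chi)) cintegralD ?cintegralZl//.
exact: cintegrableZl.
Qed.

Lemma stockwell_dist_dual : dual_schwartz_Y (stockwell_dist psi f).
Proof.
split=> [c Phi Chi sPhi sChi|Phi0 sPhi0 e e0].
  by apply: stockwell_dist_linear; exact: schwartz_Y_decreasing.
have mY := @measurable_Y R n.
have [K K0 HK] := normc_stockwell_density_le.
pose I := \int[nu]_(p in YS) (@Y_bound R n p).
have I0 : 0 <= I by apply: Rintegral_ge0 => p _; exact: Y_bound_ge0.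
(* Chosen so that [2 * K * I * del < e]; the summand 1 also covers a vanishing product. *)
pose del := e / (2 * K * I + 1).
have c0 : 0 <= 2 * K * I by rewrite !mulr_ge0.
(* One seminorm for each term in the representation of [f]. *)
exists [seq (decay_index j, 2, 0, 0, 0)%N | j <- enum 'I_N], del; split.
  by rewrite divr_gt0// ltr_wpDl.
move=> Phi sPhi small.
have dPhi := schwartz_Y_decreasing sPhi.
have dPhi0 := schwartz_Y_decreasing sPhi0.
(* The difference is put in the form [c * Phi + Chi] on which linearity was proved. *)
pose Psi (p : EY) : C := -1 * Phi0 p + Phi p.
have dPsi : decreasing_Y Psi by exact: decreasing_Y_linear.
have -> : stockwell_dist psi f Phi - stockwell_dist psi f Phi0 =
    stockwell_dist psi f Psi.
  by rewrite stockwell_dist_linear// mulN1r addrC.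
rewrite stockwell_dist_density//.
have decPsi j : decay (decay_index j) del Psi.
  have -> : Psi = (fun p => Phi p - Phi0 p).
    by apply/funext => p; rewrite /Psi mulN1r addrC.
  by apply/Y_seminorm_decay/small/map_f; rewrite mem_enum.
have iB := @integrable_Y_boundM R n (K * del).
apply: (@le_lt_trans _ _ (2 * \int[nu]_(p in YS) (K * del * @Y_bound R n p))).
  by apply: (normc_cintegral_le mY (cintegrable_stockwell_density dPsi) iB);
    exact: HK.
rewrite RintegralZl//; last first.
  apply: (integrableS measurableT mY) => //; exact: integrable_Y_bound.
rewrite -/I (_ : 2 * _ = 2 * K * I * del); last by ring.
by rewrite /del mulrA ltr_pdivrMr ?ltr_wpDl// mulrC ltr_pM2l// ltrDl.
Qed.

End stockwell_transform.

Theorem proposition6p1 (R : realType) (n : nat) (hn : (2 <= n)%N)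
    (f : ('rV[R]_n -> R[i]) -> R[i]) (psi : R -> R[i])
    (hf : DL1 f) (hpsi : schwartz1 psi) :
  dual_schwartz_Y (stockwell_dist psi f) /\
  forall Phi : 'rV[R]_n * R * R -> R[i], schwartz_Y Phi ->
    integrable_Y (fun p => stockwell_fun psi f p * Phi p) /\
    stockwell_dist psi f Phi = integral_Y (fun p => stockwell_fun psi f p * Phi p).
Proof.
have [_ [N [al [g [ig fE]]]]] := hf.
split; first exact: (stockwell_dist_dual hpsi ig fE).
move=> Phi /schwartz_Y_decreasing dPhi; split.
- exact: (cintegrable_stockwell_density hpsi ig fE dPhi).
- exact: (stockwell_dist_integral hpsi ig fE dPhi).
Qed.
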